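(* Let $m\ge 2$ be an integer, let $H$ be a Hilbert space with $\dim H\ge 2$, let $X$ be a topological linear space, and let $P\colon S^p(H)\to X$ be a continuous $m$-homogeneous polynomial with $0<p<\infty$. Suppose that $P$ is orthogonally additive on $S^p(H)$. Then $P=0$.
   Context: Hilbert spaces are complex; topological linear spaces are complex and Hausdorff. $S^p(H)$ is the Schatten class of operators $x\in\mathcal{B}(H)$ with $\|x\|_p=\operatorname{Tr}(|x|^p)^{1/p}<\infty$, topologized by $\|\cdot\|_p$ (a norm if $p\ge1$, a $p$-norm if $p<1$), where $\operatorname{Tr}$ is the usual trace. Operators $x,y$ are mutually orthogonal, $x\perp y$, if $xy^*=y^*x=0$. $P$ is orthogonally additive on $S^p(H)$ if $P(x+y)=P(x)+P(y)$ whenever $x,y\in S^p(H)$ and $x\perp y$. A map $P\colon E\to X$ between linear spaces is an $m$-homogeneous polynomial if there is an $m$-linear map $\varphi\colon E^m\to X$ with $P(x)=\varphi(x,\dots,x)$ for all $x\in E$. *)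

(* Defs.v *)
From HB Require Import structures.
From mathcomp Require Import all_boot all_order all_algebra sesquilinear.
From mathcomp Require Import all_classical all_reals all_analysis.
From mathcomp Require Import complex.

Set Implicit Arguments.
Unset Strict Implicit.
Unset Printing Implicit Defensive.

Import Order.TTheory GRing.Theory Num.Theory.
Import numFieldNormedType.Exports.

Local Open Scope classical_set_scope.
Local Open Scope complex_scope.
Local Open Scope ring_scope.

(* The inner product is linear in its first argument and conjugate-linear in
   the second one; completeness is that of the underlying normed module. *)
HB.mixin Record CompleteNormedModule_isHilbert (R : realType) H
    & CompleteNormedModule R[i] H := {
  inner : {dot H for (Num.conj : R[i] -> R[i])} ;
  inner_norm : forall u : H, inner u u = `|u| ^+ 2 }.

#[short(type="hilbertType")]
HB.structure Definition Hilbert (R : realType) :=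
  {H of CompleteNormedModule R[i] H & CompleteNormedModule_isHilbert R H}.

Definition dim_ge2 (K : fieldType) (V : lmodType K) := exists u v : V,
  forall c d : K, c *: u + d *: v = 0 -> c = 0 /\ d = 0.

Section HilbertSpaceOperators.
Context {R : realType} {H : hilbertType R}.
Implicit Types (x y a b : H -> H) (p : R).

(* An operator on H is represented by its underlying function, so that sums and
   multiples are those of the function space H -> H and the product of x and y
   is x \o y. *)
Definition op_bound x (M : R) := forall v, `|x v| <= M%:C * `|v|.

Definition bounded_op : set (H -> H) :=
  [set x | linear x /\ exists M, op_bound x M].

Definition op_cvg (a_ : nat -> H -> H) b :=
  forall e : R, 0 < e -> \forall n \near \oo, op_bound (a_ n - b) e.

(* The objects selected by [xget] below exist, and all but [hilbert_basis] are
   unique, when the argument is a bounded operator ([adjoint], [modulus]) or a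
   positive operator and f is continuous on [0, +oo) ([cfc]); the default value
   only makes the definitions total. *)
Definition adjoint x : H -> H :=
  xget 0 [set y | bounded_op y /\ forall u v, inner (x u) v = inner u (y v)].

Definition orthogonal_op x y :=
  x \o adjoint y = 0 /\ adjoint y \o x = 0.

Definition positive_op : set (H -> H) :=
  [set a | bounded_op a /\ forall v, 0 <= inner (a v) v].

Definition modulus x : H -> H :=
  xget 0 [set a | positive_op a /\ a \o a = adjoint x \o x].

Definition op_poly (q : {poly R}) a : H -> H :=
  fun v => \sum_(i < size q) (q`_i)%:C *: iter i a v.

(* Continuous functional calculus of a positive operator a: if M bounds the
   norm of a, then the spectrum of a lies in [0, M], and f(a) is the limit in
   operator norm of q_n(a) for polynomials q_n tending to f uniformly on
   [0, M]. *)
Definition cfc (f : R -> R) a : H -> H :=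
  xget 0 [set b | bounded_op b /\ exists (M : R) (q : nat -> {poly R}),
    [/\ op_bound a M,
        forall e : R, 0 < e -> \forall n \near \oo,
          forall t : R, 0 <= t <= M -> `|(q n).[t] - f t| <= e
      & op_cvg (fun n => op_poly (q n) a) b]].

Definition orthonormal_basis (B : set H) :=
  (forall u v, B u -> B v -> inner u v = (u == v)%:R) /\
  (forall v, (forall u, B u -> inner v u = 0) -> v = 0).

Definition hilbert_basis : set H := xget set0 orthonormal_basis.

(* The usual trace of a positive operator; its value does not depend on the
   orthonormal basis. *)
Definition trace a : \bar R :=
  \esum_(u in hilbert_basis) (complex.Re (inner (a u) u))%:E.

Definition schatten_norm p x : \bar R :=
  (trace (cfc (fun t => powR t p) (modulus x)) `^ p^-1)%E.

Definition schatten p : set (H -> H) :=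
  [set x | bounded_op x /\ (schatten_norm p x < +oo)%E].

Definition schatten_nbhs p x : set_system (H -> H) :=
  [set U | exists2 e : R, 0 < e & forall y, schatten p y ->
     (schatten_norm p (y - x)%R < e%:E)%E -> U y].

Definition schatten_continuous p (X : topologicalType) (P : (H -> H) -> X) :=
  forall x, schatten p x -> P @ schatten_nbhs p x --> P x.

Definition orthogonally_additive p (X : zmodType) (P : (H -> H) -> X) :=
  forall x y, schatten p x -> schatten p y -> orthogonal_op x y ->
    P (x + y) = P x + P y.

End HilbertSpaceOperators.

(* Maps on a linear subspace E of V are represented by functions on V of which
   only the values on E matter. *)
Section HomogeneousPolynomials.
Context {K : nzRingType} {V X : lmodType K}.

Definition multilinear_on (E : set V) m (phi : ('I_m -> V) -> X) :=
  forall (i : 'I_m) (w : 'I_m -> V) (c : K) (u v : V),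
    (forall j, E (w j)) -> E u -> E v ->
    phi (dfwith w i (c *: u + v)) =
      c *: phi (dfwith w i u) + phi (dfwith w i v).

Definition homogeneous_polynomial_on (E : set V) (m : nat) (P : V -> X) :=
  exists2 phi : ('I_m -> V) -> X, multilinear_on E phi &
    forall u, E u -> P u = phi (fun=> u).

End HomogeneousPolynomials.

(* Main.v *)
(* The polynomial P vanishes on rank-one operators: for u1 orthogonal to u2 and v1 to v2,
   of equal norms, and |t| = 1, the operators (u1 + t u2) (v2 + t^* v1)^* and
   (u1 - t u2) (v2 - t^* v1)^* are orthogonal, and comparing the coefficients of t^(2m)
   in the additivity relation gives 2^m P(u2 v1^* ) = 2 P(u2 v1^* ).

   Let x be in S^p, a = |x|, b = a^p and mu > 0. An orthonormal family with
   <b v, v> >= mu has at most Tr(b) / mu members, so there is a maximal orthonormal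
   family s of eigenvectors v of a with <b v, v> >= mu; let e be the projection onto
   its span. On the complement of s the operator (b - mu)_+ is zero: otherwise its
   range would be finite-dimensional and invariant under a, hence contain another
   eigenvector. So |x e - x|^p = b (1 - e) has norm at most mu and is dominated by b,
   whence x e tends to x in S^p as mu tends to 0. Finally x e is the sum of the
   pairwise orthogonal rank-one operators (x v) v^* for v in s, so P(x e) = 0. *)
Require Import Defs.
From HB Require Import structures.
From mathcomp Require Import all_boot all_order all_algebra sesquilinear.
From mathcomp Require Import all_classical all_reals all_analysis.
From mathcomp Require Import complex.
From mathcomp Require Import ring lra.

Set Implicit Arguments.
Unset Strict Implicit.
Unset Printing Implicit Defensive.

Import Order.TTheory GRing.Theory Num.Theory.
Import numFieldNormedType.Exports.

Local Open Scope classical_set_scope.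
Local Open Scope complex_scope.
Local Open Scope ring_scope.

(** * Real-valued norms and inner products *)

Section Complex.
Context {R : realType}.
Implicit Types (z : R[i]) (r : R).

(** The adjoint, the modulus, the functional calculus and the Hilbert basis are selected by [xget],
    so nothing can be computed with [schatten_norm] before their existence is proved, together with
    uniqueness for all but the basis: hence Riesz, Weierstrass and the calculus. The operator
    estimates behind the calculus come from [spectral_bound]: a bound for |q| on [0, M] also bounds
    q(a).

    In the rank-one step t enters through one factor and its conjugate through the other, so both
    operators are quadratic polynomials in t. Their linear terms cancel in the sum, whose leading
    term is twice that of each summand: this is the origin of 2^m on one side and of 2 on the other.
    The identity is known for |t| = 1 only, an infinite set, which is enough to compare
    coefficients. All operators of this step factor through one projection of rank two; such
    operators form a linear space contained in [schatten p] for every p > 0.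

    The modulus of x e - x is |x| (1 - e) because e is spanned by eigenvectors of |x| and hence
    commutes with it. *)

Definition cn z : R := complex.Re `|z|.

Lemma normcnE z : `|z| = (cn z)%:C.
Proof. by rewrite /cn RRe_real // normr_real. Qed.

Lemma cn_ge0 z : 0 <= cn z.
Proof. by rewrite -lecR -normcnE; apply: normr_ge0. Qed.

Lemma cnM z1 z2 : cn (z1 * z2) = cn z1 * cn z2.
Proof. by apply: complexI; rewrite rmorphM /= -!normcnE normrM. Qed.

Lemma cnD z1 z2 : cn (z1 + z2) <= cn z1 + cn z2.
Proof. by rewrite -lecR rmorphD /= -!normcnE ler_normD. Qed.

Lemma cn_eq0 z : (cn z == 0) = (z == 0).
Proof. by rewrite -(inj_eq (@complexI R)) -normcnE normr_eq0. Qed.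

Lemma cn_real r : cn r%:C = `|r|.
Proof. by rewrite /cn normc_def /= expr0n addr0 sqrtr_sqr. Qed.

Lemma cn_conj z : cn (Num.conj z) = cn z.
Proof. by rewrite /cn norm_conjC. Qed.

Lemma Re_conj z : complex.Re (Num.conj z) = complex.Re z.
Proof. by case: z. Qed.

Lemma conj_realC r : Num.conj (r%:C) = r%:C :> R[i].
Proof. by apply: conj_Creal; apply/complex_realP; exists r. Qed.

Lemma sqr_cn z : (cn z) ^+ 2 = complex.Re z ^+ 2 + complex.Im z ^+ 2.
Proof. by apply: complexI; rewrite rmorphXn /= -normcnE -add_Re2_Im2. Qed.

Lemma mul_conj_cn z : z * Num.conj z = (cn z ^+ 2)%:C.
Proof. by rewrite -normCK normcnE rmorphXn. Qed.

Lemma Re_le_cn z : `|complex.Re z| <= cn z.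
Proof.
rewrite -(@ler_pXn2r _ 2) ?nnegrE ?cn_ge0 // sqr_cn real_normK ?num_real //.
by rewrite lerDl sqr_ge0.
Qed.

Lemma ReD z1 z2 : complex.Re (z1 + z2) = complex.Re z1 + complex.Re z2.
Proof. by case: z1 z2 => [a b] [c d]. Qed.

Lemma ReN z : complex.Re (- z) = - complex.Re z.
Proof. by case: z. Qed.

Lemma ReZ r z : complex.Re (r%:C * z) = r * complex.Re z.
Proof. by case: z => a b /=; rewrite mul0r subr0. Qed.

Lemma Re_sum I (s : seq I) (F : I -> R[i]) :
  complex.Re (\sum_(i <- s) F i) = \sum_(i <- s) complex.Re (F i).
Proof.
by elim: s => [|i s IH]; rewrite ?big_nil // !big_cons ReD IH.
Qed.

Lemma ge0c_Re z : (0 <= z) = (z == (complex.Re z)%:C) && (0 <= complex.Re z).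
Proof. by case: z => a b; rewrite lecE eq_complex /= eqxx /=. Qed.

End Complex.

Section InnerProduct.
Context {R : realType} {H : hilbertType R}.
Implicit Types (u v w : H) (c : R[i]) (r : R).

(** Norms of [H] take values in [R[i]]; [nrm], [rip] and [cn] are real-valued, so that estimates
    take place in the ordered field [R]. *)
Definition nrm v : R := complex.Re `|v|.
Definition rip u v : R := complex.Re (inner u v).

Lemma normE v : `|v| = (nrm v)%:C.
Proof. by rewrite /nrm RRe_real // normr_real. Qed.

Lemma nrm_ge0 v : 0 <= nrm v.
Proof. by rewrite -lecR -normE; apply: normr_ge0. Qed.

Lemma nrm_eq0 v : (nrm v == 0) = (v == 0).
Proof. by rewrite -(inj_eq (@complexI R)) -normE normr_eq0. Qed.

Lemma nrm0 : nrm 0 = 0.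
Proof. by apply/eqP; rewrite nrm_eq0. Qed.

Lemma nrmZ c v : nrm (c *: v) = cn c * nrm v.
Proof. by apply: complexI; rewrite rmorphM /= -!normE -normcnE normrZ. Qed.

Lemma nrmZr r v : nrm (r%:C *: v) = `|r| * nrm v.
Proof. by rewrite nrmZ cn_real. Qed.

Lemma nrmN v : nrm (- v) = nrm v.
Proof. by rewrite /nrm normrN. Qed.

Lemma nrmB u v : nrm (u - v) = nrm (v - u).
Proof. by rewrite /nrm distrC. Qed.

Lemma nrmD u v : nrm (u + v) <= nrm u + nrm v.
Proof. by rewrite -lecR rmorphD /= -!normE ler_normD. Qed.

Lemma innerDl u v w : inner (u + v) w = inner u w + inner v w.
Proof. exact: linearDl. Qed.
Lemma innerDr u v w : inner u (v + w) = inner u v + inner u w.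
Proof. exact: linearDr. Qed.
Lemma innerNl u v : inner (- u) v = - inner u v.
Proof. exact: linearNl. Qed.
Lemma innerNr u v : inner u (- v) = - inner u v.
Proof. exact: linearNr. Qed.
Lemma inner0l v : inner 0 v = 0.
Proof. exact: linear0l. Qed.
Lemma inner0r v : inner v 0 = 0.
Proof. exact: linear0r. Qed.
Lemma innerZl c u v : inner (c *: u) v = c * inner u v.
Proof. exact: linearZl_LR. Qed.
Lemma innerZr c u v : inner u (c *: v) = Num.conj c * inner u v.
Proof. exact: linearZr_LR. Qed.
Lemma innerC u v : inner u v = Num.conj (inner v u).
Proof. by rewrite (hermC inner u v) expr0 mul1r. Qed.
Lemma inner_suml I (s : seq I) (F : I -> H) v :
  inner (\sum_(i <- s) F i) v = \sum_(i <- s) inner (F i) v.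
Proof. by apply: (big_morph (inner^~ v)) => [x y|]; rewrite ?innerDl ?inner0l. Qed.
Lemma inner_sumr I (s : seq I) (F : I -> H) v :
  inner v (\sum_(i <- s) F i) = \sum_(i <- s) inner v (F i).
Proof. by apply: (big_morph (inner v)) => [x y|]; rewrite ?innerDr ?inner0r. Qed.

Lemma innervv v : inner v v = (nrm v ^+ 2)%:C.
Proof. by rewrite inner_norm normE rmorphXn. Qed.

Lemma inner_eq0C u v : inner u v = 0 -> inner v u = 0.
Proof. by rewrite innerC => /eqP; rewrite conjC_eq0 => /eqP. Qed.

Lemma ripvv v : rip v v = nrm v ^+ 2.
Proof. by rewrite /rip innervv. Qed.

Lemma ripC u v : rip u v = rip v u.
Proof. by rewrite /rip innerC Re_conj. Qed.

Lemma ripDl u v w : rip (u + v) w = rip u w + rip v w.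
Proof. by rewrite /rip innerDl ReD. Qed.
Lemma ripDr u v w : rip w (u + v) = rip w u + rip w v.
Proof. by rewrite /rip innerDr ReD. Qed.
Lemma ripNl u v : rip (- u) v = - rip u v.
Proof. by rewrite /rip innerNl ReN. Qed.
Lemma ripNr u v : rip u (- v) = - rip u v.
Proof. by rewrite /rip innerNr ReN. Qed.
Lemma ripZl r u v : rip (r%:C *: u) v = r * rip u v.
Proof. by rewrite /rip innerZl ReZ. Qed.
Lemma ripZr r u v : rip u (r%:C *: v) = r * rip u v.
Proof. by rewrite ripC ripZl ripC. Qed.
Lemma rip0l v : rip 0 v = 0. Proof. by rewrite /rip inner0l. Qed.

Lemma sqr_nrmD u v : nrm (u + v) ^+ 2 = nrm u ^+ 2 + 2 * rip u v + nrm v ^+ 2.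
Proof. by rewrite -!ripvv !(ripDl, ripDr) (ripC v u); ring. Qed.

Lemma sqr_nrmB u v : nrm (u - v) ^+ 2 = nrm u ^+ 2 - 2 * rip u v + nrm v ^+ 2.
Proof. by rewrite sqr_nrmD nrmN ripNr; ring. Qed.

Lemma ler_sqr_nrm (a b : R) : 0 <= b -> a ^+ 2 <= b ^+ 2 -> a <= b.
Proof.
move=> b0 h; case: (leP a 0) => [a0|/ltW a0]; first exact: le_trans a0 b0.
by rewrite -(@ler_pXn2r _ 2).
Qed.

Lemma cauchy_schwarz u v : cn (inner u v) <= nrm u * nrm v.
Proof.
have [->|v0] := eqVneq v 0; first by rewrite inner0r nrm0 mulr0 cn_real normr0.
have Nv : 0 < nrm v by rewrite lt0r nrm_ge0 nrm_eq0 v0.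
apply: ler_sqr_nrm; first by rewrite mulr_ge0 ?nrm_ge0.
(* This vector is |v|^2 times the component of [u] orthogonal to [v]; its squared norm is |v|^2
   (|u|^2 |v|^2 - |<u, v>|^2). *)
have : 0 <= nrm ((nrm v ^+ 2)%:C *: u - inner u v *: v) ^+ 2 by rewrite sqr_ge0.
rewrite sqr_nrmB nrmZr nrmZ ger0_norm ?sqr_ge0 // ripZl.
have -> : rip u (inner u v *: v) = cn (inner u v) ^+ 2.
  by rewrite /rip innerZr mulrC mul_conj_cn.
set t := cn _; set n := nrm v; set m := nrm u => h.
have {h} : 0 <= n ^+ 2 * ((m * n) ^+ 2 - t ^+ 2).
  by apply: le_trans h _; rewrite le_eqVlt; apply/orP; left; apply/eqP; ring.
by rewrite pmulr_rge0 ?exprn_gt0 // subr_ge0.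
Qed.

Lemma rip_le u v : rip u v <= nrm u * nrm v.
Proof.
by apply: le_trans (cauchy_schwarz u v); apply: le_trans (Re_le_cn _); apply: ler_norm.
Qed.

Lemma inner_eqP u v : (forall w, inner w u = inner w v) -> u = v.
Proof.
move=> h; apply/eqP; rewrite -subr_eq0 -nrm_eq0 -sqrf_eq0 -ripvv.
by rewrite /rip innerDr innerNr h subrr.
Qed.

(** Identities obtained by approximation end here, with [K] collecting the norms of the vectors
    involved. *)
Lemma nrm_small u (K : R) : (forall e, 0 < e -> nrm u <= e * K) -> u = 0.
Proof.
move=> h; apply/eqP; rewrite -nrm_eq0 eq_le nrm_ge0 andbT.
have K1 : 0 < 1 + `|K| by rewrite ltr_pwDl // ltr01.
apply/ler_addgt0Pl => e e0; rewrite addr0.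
apply: le_trans (h (e / (1 + `|K|)) _) _; first by rewrite divr_gt0.
rewrite mulrAC ler_pdivrMr // ler_pM2l //.
by apply: le_trans (ler_norm _) _; rewrite lerDr ler01.
Qed.

Lemma op_boundE (x : H -> H) (M : R) :
  op_bound x M <-> forall v, nrm (x v) <= M * nrm v.
Proof.
by split=> h v; move: (h v); rewrite !normE -rmorphM /= lecR.
Qed.

End InnerProduct.

(** * Riesz representation and adjoints *)

Section Riesz.
Context {R : realType} {H : hilbertType R}.
Implicit Types (u v w : H) (c : R[i]) (r e : R).

Lemma nrm_complete (w : nat -> H) :
  (forall e, 0 < e -> exists N, forall n m, (N <= n)%N -> (N <= m)%N ->
    nrm (w n - w m) <= e) ->
  exists v, forall e, 0 < e -> exists N, forall n, (N <= n)%N -> nrm (v - w n) <= e.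
Proof.
move=> hw; have cw : cvg (w @ \oo).
  apply/cauchy_cvgP/cauchy_exP => e e0.
  (* A positive element of [R[i]] is real, by the definition of its order. *)
  have [Re0 eE] : 0 < complex.Re e /\ e = (complex.Re e)%:C.
    by move: e0; rewrite lt0r ge0c_Re => /andP[n0 /andP[/eqP h r0]]; split => //;
       rewrite lt0r r0 andbT; apply: contraNneq n0 => r1; rewrite h r1.
  have [N hN] := hw _ (divr_gt0 Re0 (@ltr0Sn R 1)).
  exists (w N); exists N => // n /= Nn.
  rewrite -ball_normE /= normE eE ltcR.
  apply: le_lt_trans (hN _ _ (leqnn _) Nn) _.
  by rewrite ltr_pdivrMr // ltr_pMr // ltr1n.
exists (lim (w @ \oo)) => e e0.
have /cvgrPdist_le /(_ e%:C) := cw.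
rewrite ltcR => /(_ e0)[N _ hN]; exists N => n Nn.
by have := hN n Nn; rewrite /= normE lecR.
Qed.

(** * Minimisation of the Riesz functional over a subspace *)

Section Minimisation.
Variables (K : set H) (F : H -> R[i]) (C : R).
Hypothesis K0 : K 0.
Hypothesis KL : forall c u v, K u -> K v -> K (c *: u + v).
Hypothesis FL : forall c u v, K u -> K v -> F (c *: u + v) = c * F u + F v.
Hypothesis FC : forall u, K u -> cn (F u) <= C * nrm u.

(** If [F u] is <u, v>, then [J u] is |u - v|^2 - |v|^2: minimising [J] over [K] approaches the
    point of the closure of [K] nearest to [v]. *)
Let J u : R := nrm u ^+ 2 - 2 * complex.Re (F u).

Lemma riesz_functional_lb u : K u -> - C ^+ 2 <= J u.
Proof.
move=> Ku; have := FC Ku; have := Re_le_cn (F u); have := ler_norm (complex.Re (F u)).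
rewrite /J; set a := complex.Re _; set n := nrm u; set b := cn _ => h1 h2 h3.
have : 0 <= (n - C) ^+ 2 by rewrite sqr_ge0.
have : a <= C * n by lra.
nra.
Qed.

(** The parallelogram law: |u - v|^2 equals 2 J(u) + 2 J(v) - 4 J((u + v) / 2), and the last value
    of [J] is at least [d]. *)
Lemma riesz_near_minimisers (d e1 e2 : R) u v :
  (forall w, K w -> d <= J w) -> K u -> K v -> J u <= d + e1 -> J v <= d + e2 ->
  nrm (u - v) ^+ 2 <= 2 * (e1 + e2).
Proof.
move=> hd Ku Kv Ju Jv.
have Kuv : K ((1/2)%:C *: (u + v)).
  have := KL (1/2)%:C (KL 1 Ku Kv) K0; by rewrite scale1r addr0.
have FE : complex.Re (F ((1/2)%:C *: (u + v))) = 1/2 * (complex.Re (F u) + complex.Re (F v)).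
  have := FL (1/2)%:C (KL 1 Ku Kv) K0.
  have := FL 1 Ku Kv; rewrite !scale1r mul1r => -> .
  have F0 : F 0 = 0.
    have := FL 1 K0 K0; rewrite scaler0 addr0 mul1r => /eqP.
    by rewrite -subr_eq subrr eq_sym => /eqP.
  by rewrite F0 !addr0 => ->; rewrite ReZ ReD.
have := hd _ Kuv; move: Ju Jv; rewrite /J FE nrmZr exprMn.
rewrite sqr_nrmB sqr_nrmD real_normK ?num_real // expr2.
set a := nrm u ^+ 2; set b := nrm v ^+ 2; set r := rip u v.
set p := complex.Re _; set q := complex.Re _.
by move=> h1 h2 h3; lra.
Qed.

Lemma riesz_near_representation (d e : R) u w :
  (forall w, K w -> d <= J w) -> K u -> J u <= d + e -> K w ->
  cn (F w - inner w u) ^+ 2 <= (1 + nrm w ^+ 2) * e.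
Proof.
move=> hd Ku Ju Kw; set D := F w - inner w u; set k := 1 + nrm w ^+ 2.
have k0 : 0 < k by rewrite /k ltr_pwDl ?ltr01 ?sqr_ge0.
(* Moving from [u] to [s *: w + u] lowers [J] by 2 |D|^2 / k to first order and raises it by at most
   |D|^2 / k to second order; the summand 1 in [k] allows [w = 0]. *)
pose s := (k^-1)%:C * Num.conj D.
have := hd _ (KL s Kw Ku); rewrite /J FL // sqr_nrmD ReD.
have cns : cn s = k^-1 * cn D by rewrite /s cnM cn_real cn_conj ger0_norm // invr_ge0 ltW.
rewrite nrmZ cns.
have h1 : complex.Re (s * D) = k^-1 * cn D ^+ 2.
  by rewrite /s -mulrA ReZ mulrC [Num.conj D * D]mulrC mul_conj_cn mulrC.
have h2 : complex.Re (s * D) = complex.Re (s * F w) - rip (s *: w) u.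
  by rewrite /D mulrBr ReD ReN /rip innerZl.
move: Ju; rewrite /J.
set a := complex.Re (s * F w) in h2 *; set b := rip _ _ in h2 *.
set n := nrm u ^+ 2; set f := complex.Re (F u) => h3 h4.
have h5 : 2 * (k^-1 * cn D ^+ 2) - (k^-1 * cn D * nrm w) ^+ 2 <= e by lra.
have -> : cn D ^+ 2 = k * (k^-1 * cn D ^+ 2) by rewrite mulVKf // gt_eqF.
rewrite ler_pM2l //; apply: le_trans h5.
have : (k^-1 * cn D * nrm w) ^+ 2 = (k^-1 * cn D ^+ 2) * (1 - k^-1).
  have nE : nrm w ^+ 2 = k - 1 by rewrite /k addrC addKr.
  rewrite !exprMn nE.
  by field; rewrite gt_eqF.
move=> ->.
have : 0 <= k^-1 * cn D ^+ 2 * k^-1.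
  by do 2?apply: mulr_ge0; rewrite ?sqr_ge0 ?invr_ge0 ?ltW.
set z := _ * _ * k^-1 => z0; rewrite mulrBr mulr1 -/z; lra.
Qed.

(** [K] is an arbitrary subspace, hence [v] is only in its closure. The whole space gives adjoints;
    the span of a Hilbert basis gives the Parseval inequality. *)
Lemma riesz_approx : exists v,
  (forall e, 0 < e -> exists2 w, K w & nrm (v - w) <= e) /\
  forall w, K w -> F w = inner w v.
Proof.
pose S := [set J u | u in K].
have hS : has_inf S.
  split; first by exists (J 0), 0.
  by exists (- C ^+ 2) => _ [u Ku <-]; apply: riesz_functional_lb.
pose d := inf S.
have hd w : K w -> d <= J w.
  by move=> Kw; apply: (ge_inf hS.2); exists w.
have hn n : exists u, K u /\ J u <= d + n.+1%:R^-1.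
  have n0 : (0 : R) < n.+1%:R^-1 by rewrite invr_gt0 ltr0Sn.
  have [_ [u Ku <-] h] := inf_adherent n0 hS.
  by exists u; split => //; apply: ltW.
have [w hw] := choice hn.
have small e : 0 < e -> exists N, forall n, (N <= n)%N -> n.+1%:R^-1 <= e.
  move=> e0; exists (Num.truncn e^-1) => n Nn.
  rewrite invf_ple ?posrE ?ltr0Sn //.
  apply: ltW; apply: lt_le_trans (truncnS_gt _) _.
  by rewrite ler_nat ltnS.
have [v hv] : exists v, forall e, 0 < e -> exists N, forall n, (N <= n)%N -> nrm (v - w n) <= e.
  apply: nrm_complete => e e0.
  have [N hN] := small (e ^+ 2 / 4) (divr_gt0 (exprn_gt0 _ e0) (ltr0Sn _ _)).
  exists N => n m Nn Nm; apply: ler_sqr_nrm; first exact: ltW.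
  apply: le_trans (riesz_near_minimisers hd (hw n).1 (hw m).1 (hw n).2 (hw m).2) _.
  move: (hN n Nn) (hN m Nm); move: (n.+1%:R^-1) (m.+1%:R^-1) (e ^+ 2) => a b c; lra.
exists v; split => [e e0|u Ku].
  by have [N hN] := hv e e0; exists (w N); [exact: (hw N).1|exact: hN].
apply/eqP; rewrite -subr_eq0 -cn_eq0 eq_le cn_ge0 andbT.
apply/ler_addgt0Pl => e e0; rewrite addr0.
pose k := 1 + nrm u ^+ 2.
have k0 : 0 < k by rewrite /k ltr_pwDl ?ltr01 ?sqr_ge0.
have [N1 hN1] := small ((e / 2) ^+ 2 / k) (divr_gt0 (exprn_gt0 _ (divr_gt0 e0 (ltr0Sn _ _))) k0).
have u1 : 0 < 1 + nrm u by rewrite ltr_pwDl ?ltr01 ?nrm_ge0.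
have [N2 hN2] := hv _ (divr_gt0 (divr_gt0 e0 (ltr0Sn _ 1)) u1).
pose n := maxn N1 N2.
have h1 := hN1 n (leq_maxl _ _); have h2 := hN2 n (leq_maxr _ _).
have h3 := riesz_near_representation hd (hw n).1 (hw n).2 Ku.
have -> : F u - inner u v = (F u - inner u (w n)) + inner u (w n - v).
  by rewrite innerDr innerNr addrA subrK.
apply: le_trans (cnD _ _) _.
rewrite [e]splitr lerD //.
  apply: ler_sqr_nrm; first by rewrite ltW ?divr_gt0.
  apply: le_trans h3 _; rewrite -/k.
  by rewrite mulrC -ler_pdivlMr.
apply: le_trans (cauchy_schwarz _ _) _.
rewrite nrmB mulrC; apply: le_trans (_ : nrm (v - w n) * (1 + nrm u) <= _).
  by rewrite ler_wpM2l ?nrm_ge0 // lerDr ler01.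
by rewrite -ler_pdivlMr.
Qed.
End Minimisation.
End Riesz.

Section Adjoint.
Context {R : realType} {H : hilbertType R}.
Implicit Types (u v w : H) (c : R[i]) (r e : R) (x y a : H -> H).

Section Linear.
Variable x : H -> H.
Hypothesis lx : linear x.
Lemma linD u v : x (u + v) = x u + x v.
Proof. by have := lx 1 u v; rewrite !scale1r. Qed.
Lemma lin0 : x 0 = 0.
Proof. by have := linD 0 0; rewrite addr0 => /eqP; rewrite -subr_eq subrr eq_sym => /eqP. Qed.
Lemma linZ c u : x (c *: u) = c *: x u.
Proof. by have := lx c u 0; rewrite !addr0 lin0 addr0. Qed.
Lemma linN u : x (- u) = - x u.
Proof. by rewrite -scaleN1r linZ scaleN1r. Qed.
Lemma linB u v : x (u - v) = x u - x v.
Proof. by rewrite linD linN. Qed.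
Lemma lin_sum I (s : seq I) (F : I -> H) :
  x (\sum_(i <- s) F i) = \sum_(i <- s) x (F i).
Proof. by apply: (big_morph x); [exact: linD|exact: lin0]. Qed.
End Linear.

Lemma lin_comp x y : linear x -> linear y -> linear (x \o y).
Proof. by move=> lx ly c u v /=; rewrite ly lx. Qed.

Lemma op_bound_ge0 x M : op_bound x M -> op_bound x (Num.max M 0).
Proof.
move=> /op_boundE h; apply/op_boundE => v; apply: le_trans (h v) _.
by rewrite ler_wpM2r ?nrm_ge0 // le_max lexx.
Qed.

Lemma bounded_opP x : bounded_op x -> exists2 M, 0 <= M & forall v, nrm (x v) <= M * nrm v.
Proof.
move=> [_ [M /op_bound_ge0 /op_boundE h]]; exists (Num.max M 0) => //.
by rewrite le_max lexx orbT.
Qed.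

Lemma bounded_op_comp x y : bounded_op x -> bounded_op y -> bounded_op (x \o y).
Proof.
move=> bx bY; split; first by apply: lin_comp; [exact: bx.1|exact: bY.1].
have [M M0 hM] := bounded_opP bx; have [L L0 hL] := bounded_opP bY.
exists (M * L); apply/op_boundE => v /=; apply: le_trans (hM _) _.
by rewrite -mulrA ler_wpM2l.
Qed.

Lemma bounded_opD x y : bounded_op x -> bounded_op y -> bounded_op (x + y).
Proof.
move=> bx bY; split=> [c u v|].
  by rewrite !fctE bx.1 bY.1 scalerDr addrACA.
have [M M0 hM] := bounded_opP bx; have [L L0 hL] := bounded_opP bY.
exists (M + L); apply/op_boundE => v /=; rewrite fctE.
by apply: le_trans (nrmD _ _) _; rewrite mulrDl lerD.
Qed.

Lemma bounded_opZ c x : bounded_op x -> bounded_op (c *: x).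
Proof.
move=> bx; split=> [d u v|].
  by rewrite !fctE bx.1 scalerDr !scalerA mulrC.
have [M M0 hM] := bounded_opP bx.
exists (cn c * M); apply/op_boundE => v /=; rewrite fctE nrmZ -mulrA.
by rewrite ler_wpM2l // cn_ge0.
Qed.

Lemma bounded_opN x : bounded_op x -> bounded_op (- x).
Proof. by move=> bx; rewrite -scaleN1r; apply: bounded_opZ. Qed.

Lemma bounded_op_id : bounded_op (id : H -> H).
Proof. by split=> //; exists 1; apply/op_boundE => v; rewrite mul1r. Qed.

Lemma adjoint_exists x : bounded_op x ->
  exists y, bounded_op y /\ forall u v, inner (x u) v = inner u (y v).
Proof.
move=> bx; have [M M0 hM] := bounded_opP bx.
have hy v : exists z, forall u, inner (x u) v = inner u z.
  have [|||z [_ hz]] := @riesz_approx R H setT (fun u => inner (x u) v) (M * nrm v) I.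
  - by [].
  - by move=> c u w _ _; rewrite bx.1 innerDl innerZl.
  - move=> u _; apply: le_trans (cauchy_schwarz _ _) _.
    by rewrite mulrAC ler_wpM2r ?nrm_ge0.
  by exists z => u; apply: hz.
have [y yE] := choice hy; exists y; split => //; split.
  move=> c u v; apply: inner_eqP => w.
  by rewrite -yE !innerDr !innerZr !yE.
exists M; apply/op_boundE => v; have [y0|y0] := eqVneq (nrm (y v)) 0.
  by rewrite y0 mulr_ge0 ?nrm_ge0.
(* The adjoint relation at [u = y v] gives |y v|^2 <= M |y v| |v|. *)
rewrite -(ler_pM2r (_ : 0 < nrm (y v))) ?lt0r ?y0 ?nrm_ge0 // -expr2 -ripvv.
rewrite /rip -yE; apply: le_trans (rip_le _ _) _.
by rewrite mulrAC ler_wpM2r ?nrm_ge0.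
Qed.

Lemma adjointP x : bounded_op x ->
  bounded_op (adjoint x) /\ forall u v, inner (x u) v = inner u (adjoint x v).
Proof. by move=> /adjoint_exists[y hy]; rewrite /adjoint; case: xgetP => [z _ //|/(_ y)]; case. Qed.

Lemma adjoint_uniq x y : bounded_op y ->
  (forall u v, inner (x u) v = inner u (y v)) -> adjoint x = y.
Proof.
move=> bY yE; rewrite /adjoint; case: xgetP => [z _ [_ zE]|/(_ y)]; last by case.
by apply/funext => v; apply: inner_eqP => u; rewrite -zE -yE.
Qed.

(** Polarisation: the imaginary part of <a w, w> vanishes for w equal to u, v, u + v and u + i v. *)
Lemma linear_positive_selfadjoint a : linear a -> (forall v, 0 <= inner (a v) v) ->
  forall u v, inner (a u) v = inner u (a v).
Proof.
move=> la pa u v.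
have im w : complex.Im (inner (a w) w) = 0 by apply: ger0_Im.
have h1 := im (u + v); have h2 := im (u + 'i *: v).
rewrite !(linD la) !(linZ la) !(innerDl, innerDr, innerZl, innerZr) in h1 h2.
rewrite [inner u (a v)]innerC.
have := im u; have := im v; move: h1 h2.
case: (inner (a u) u) => a1 a2; case: (inner (a v) v) => b1 b2.
case: (inner (a u) v) => p1 p2; case: (inner (a v) u) => q1 q2 /=.
move=> h1 h2 h3 h4; apply/eqP; rewrite eq_complex /=; apply/andP; split; apply/eqP; lra.
Qed.

Lemma positive_selfadjoint a : positive_op a -> forall u v, inner (a u) v = inner u (a v).
Proof. by move=> [[la _] pa]; apply: linear_positive_selfadjoint. Qed.

Lemma positive_innerE a v : positive_op a -> inner (a v) v = (rip (a v) v)%:C.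
Proof. by move=> [_ /(_ v)]; rewrite ge0c_Re => /andP[/eqP]. Qed.

Lemma positive_rip a v : positive_op a -> 0 <= rip (a v) v.
Proof. by move=> [_ /(_ v)]; rewrite ge0c_Re => /andP[_]. Qed.

Lemma selfadjoint_positive a : bounded_op a -> (forall u v, inner (a u) v = inner u (a v)) ->
  (forall v, 0 <= rip (a v) v) -> positive_op a.
Proof.
move=> ba sa ra; split=> // v; rewrite ge0c_Re ra andbT.
have := innerC (a v) v; rewrite -sa; case: (inner (a v) v) => p q /= [/eqP].
by rewrite -subr_eq0 opprK -mulr2n mulrn_eq0 => /eqP ->.
Qed.
End Adjoint.

(** * Polynomials in a positive operator *)

Section OperatorPolynomials.
Context {R : realType} {H : hilbertType R}.
Implicit Types (u v w : H) (c z : R[i]) (r e M : R) (x y a : H -> H).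

(** [op_poly] with complex coefficients, over which polynomials split into linear factors. *)
Definition pev (q : {poly R[i]}) a v := \sum_(i < size q) q`_i *: iter i a v.

Lemma pev_wide n (q : {poly R[i]}) a v : (size q <= n)%N ->
  pev q a v = \sum_(i < n) q`_i *: iter i a v.
Proof.
move=> qn; rewrite /pev (big_ord_widen n (fun i => q`_i *: iter i a v)) //.
rewrite big_mkcond /=; apply: eq_bigr => i _; case: ltnP => // h.
by rewrite nth_default // scale0r.
Qed.

Lemma pevD (q r : {poly R[i]}) a v : pev (q + r) a v = pev q a v + pev r a v.
Proof.
pose n := maxn (size q) (size r).
rewrite !(@pev_wide n) ?leq_maxl ?leq_maxr ?size_polyD // -big_split /=.
by apply: eq_bigr => i _; rewrite coefD scalerDl.
Qed.

Lemma pevZ c (q : {poly R[i]}) a v : pev (c *: q) a v = c *: pev q a v.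
Proof.
rewrite (@pev_wide (size q)) ?size_scale_leq // scaler_sumr.
by apply: eq_bigr => i _; rewrite coefZ scalerA.
Qed.

Lemma pev0 a v : pev 0 a v = 0.
Proof. by rewrite /pev size_poly0 big_ord0. Qed.

Lemma pevC c a v : pev c%:P a v = c *: v.
Proof.
rewrite (@pev_wide 1) ?size_polyC_leq1 // big_ord_recl big_ord0 addr0.
by rewrite coefC.
Qed.

Lemma pevXn n a v : pev 'X^n a v = iter n a v.
Proof.
rewrite (@pev_wide n.+1) ?size_polyXn // big_ord_recr big1 /= => [|i _].
  by rewrite coefXn eqxx scale1r add0r.
by rewrite coefXn (ltn_eqF (ltn_ord i)) scale0r.
Qed.

Lemma pevX a v : pev 'X a v = a v.
Proof. by rewrite -['X]expr1 pevXn. Qed.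

Lemma pev_mulX (q : {poly R[i]}) a v : pev (q * 'X) a v = pev q a (a v).
Proof.
rewrite (@pev_wide (size q).+1); last first.
  by have [->|q0] := eqVneq q 0; rewrite ?mul0r ?size_poly0 // size_mulX.
rewrite big_ord_recl coefMX eqxx scale0r add0r; apply: eq_bigr => i _.
by rewrite coefMX /= -iterS iterSr.
Qed.

Section Linear.
Variable a : H -> H.
Hypothesis la : linear a.

Lemma pev_comm (q : {poly R[i]}) v : pev q a (a v) = a (pev q a v).
Proof.
rewrite /pev (lin_sum la); apply: eq_bigr => i _.
by rewrite (linZ la) -iterS iterSr.
Qed.

Lemma pevM (q r : {poly R[i]}) v : pev (q * r) a v = pev q a (pev r a v).
Proof.
elim/poly_ind: q r v => [|q c IH] r v.
  by rewrite mul0r !pev0.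
rewrite mulrDl !pevD mul_polyC pevZ pevC pev_mulX; congr (_ + _).
by rewrite -mulrA [_ * r]mulrC IH pev_mulX pev_comm.
Qed.

Lemma pev_linear (q : {poly R[i]}) : linear (pev q a).
Proof.
elim/poly_ind: q => [|q c IH] d u v.
  by rewrite !pev0 scaler0 addr0.
rewrite !pevD !pev_mulX !pevC la IH.
by rewrite !scalerDr !scalerA [c * d]mulrC addrACA.
Qed.

Lemma pev_eigen (q : {poly R[i]}) z v : a v = z *: v -> pev q a v = q.[z] *: v.
Proof.
move=> av; elim/poly_ind: q => [|q c IH].
  by rewrite pev0 horner0 scale0r.
by rewrite pevD pev_mulX pevC av (linZ (pev_linear q)) IH !hornerE scalerDl scalerA mulrC.
Qed.

(** The fold applies one factor a - z at a time, so that properties of single factors pass to the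
    product. *)
Lemma pev_prod_root (s : seq R[i]) v : pev (\prod_(z <- s) ('X - z%:P)) a v =
  foldr (fun z w => a w - z *: w) v s.
Proof.
elim: s => [|z s IH]; first by rewrite big_nil pevC scale1r.
by rewrite big_cons pevM pevD pevX -polyCN pevC scaleNr IH.
Qed.

End Linear.

Lemma pev_bounded (q : {poly R[i]}) a : bounded_op a -> bounded_op (pev q a).
Proof.
move=> ba; elim/poly_ind: q => [|q c IH].
  suff -> : pev 0 a = 0 *: id by apply/bounded_opZ/bounded_op_id.
  by apply/funext => v; rewrite pev0 fctE scale0r.
suff -> : pev (q * 'X + c%:P) a = (pev q a \o a) + c *: id.
  by apply: bounded_opD; [exact: bounded_op_comp|exact/bounded_opZ/bounded_op_id].
by apply/funext => v; rewrite pevD pev_mulX pevC !fctE.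
Qed.

Definition polyRC (q : {poly R}) : {poly R[i]} := map_poly (real_complex R) q.

Lemma op_polyE (q : {poly R}) a : op_poly q a = pev (polyRC q) a.
Proof.
apply/funext => v; rewrite /op_poly /pev size_map_poly.
by apply: eq_bigr => i _; rewrite coef_map.
Qed.

Lemma polyRC_horner (q : {poly R}) (t : R) : (polyRC q).[t%:C] = (q.[t])%:C.
Proof. exact: horner_map. Qed.

Lemma op_polyD (q r : {poly R}) a : op_poly (q + r) a = op_poly q a + op_poly r a.
Proof. by rewrite !op_polyE; apply/funext => v; rewrite fctE -pevD /polyRC rmorphD. Qed.

Lemma op_polyZ (c : R) (q : {poly R}) a : op_poly (c *: q) a = c%:C *: op_poly q a.
Proof.
by rewrite !op_polyE; apply/funext => v; rewrite fctE -pevZ /polyRC map_polyZ.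
Qed.

Lemma op_polyB (q r : {poly R}) a : op_poly (q - r) a = op_poly q a - op_poly r a.
Proof. by rewrite -scaleN1r op_polyD op_polyZ rmorphN1 scaleN1r. Qed.

Lemma op_polyC (c : R) a v : op_poly c%:P a v = c%:C *: v.
Proof. by rewrite op_polyE /polyRC map_polyC pevC. Qed.

Lemma op_polyM (q r : {poly R}) a v : linear a ->
  op_poly (q * r) a v = op_poly q a (op_poly r a v).
Proof. by move=> la; rewrite !op_polyE /polyRC rmorphM pevM. Qed.

Lemma op_polyX a : op_poly 'X a = a.
Proof. by apply/funext => v; rewrite op_polyE /polyRC map_polyX pevX. Qed.

Lemma op_poly_bounded (q : {poly R}) a : bounded_op a -> bounded_op (op_poly q a).
Proof. by move=> ba; rewrite op_polyE; apply: pev_bounded. Qed.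

Lemma op_poly_eigen (q : {poly R}) (t : R) a v : linear a -> a v = t%:C *: v ->
  op_poly q a v = (q.[t])%:C *: v.
Proof. by move=> la av; rewrite op_polyE (pev_eigen la _ av) polyRC_horner. Qed.

Lemma op_poly_comm (q : {poly R}) a y v : linear a -> linear y ->
  (forall w, y (a w) = a (y w)) -> y (op_poly q a v) = op_poly q a (y v).
Proof.
move=> la ly ya; rewrite /op_poly (lin_sum ly); apply: eq_bigr => i _.
rewrite (linZ ly); congr (_ *: _); elim: (nat_of_ord i) => //= n IH.
by rewrite ya IH.
Qed.

Lemma op_poly_selfadjoint (q : {poly R}) a :
  (forall u v, inner (a u) v = inner u (a v)) ->
  forall u v, inner (op_poly q a u) v = inner u (op_poly q a v).
Proof.
move=> sa u v; rewrite /op_poly inner_suml inner_sumr; apply: eq_bigr => i _.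
rewrite innerZl innerZr conj_realC; congr (_ * _).
elim: (nat_of_ord i) u v => //= n IH u v; by rewrite sa IH -iterSr.
Qed.

End OperatorPolynomials.

(** * Polynomials in a positive operator are controlled by their values on [0, M] *)

Section SpectralBound.
Context {R : realType} {H : hilbertType R}.
Variables (a : H -> H) (M : R).
Hypothesis pa : positive_op a.
Hypothesis aM : op_bound a M.
Hypothesis M0 : 0 <= M.

Let la : linear a := pa.1.1.

Lemma Im_le_cn (z : R[i]) : `|complex.Im z| <= cn z.
Proof.
rewrite -(@ler_pXn2r _ 2) ?nnegrE ?cn_ge0 // sqr_cn real_normK ?num_real //.
by rewrite lerDr sqr_ge0.
Qed.

Lemma rip_positive_le v : rip (a v) v <= M * nrm v ^+ 2.
Proof.
apply: le_trans (rip_le _ _) _; rewrite expr2 mulrA ler_wpM2r ?nrm_ge0 //.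
by have /op_boundE := aM; apply.
Qed.

(** The numerical range of [a] lies in [0, M]. Off this interval the modulus of <(a - z) v, v> is at
    least |v|^2 times |Im z|, - Re z or Re z - M, according to the position of [z]; Cauchy-Schwarz
    does the rest. *)
Lemma resolvent_bounded_below (z : R[i]) : (forall t, 0 <= t <= M -> z <> t%:C) ->
  exists2 d : R, 0 < d & forall v, d * nrm v <= nrm (a v - z *: v).
Proof.
move=> hz.
have aux (d : R) : 0 < d -> (forall v, d * nrm v ^+ 2 <= cn (inner (a v - z *: v) v)) ->
    exists2 d : R, 0 < d & forall v, d * nrm v <= nrm (a v - z *: v).
  move=> d0 h; exists d => // v; have [->|v0] := eqVneq v 0.
    by rewrite nrm0 mulr0 nrm_ge0.
  have Nv : 0 < nrm v by rewrite lt0r nrm_ge0 nrm_eq0 v0.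
  rewrite -(ler_pM2r Nv) -mulrA -expr2.
  by apply: le_trans (h v) _; apply: cauchy_schwarz.
have E v : inner (a v - z *: v) v = (rip (a v) v)%:C - z * (nrm v ^+ 2)%:C.
  by rewrite innerDl innerNl innerZl innervv positive_innerE.
have [zi|zi] := eqVneq (complex.Im z) 0; last first.
  apply: (aux `|complex.Im z|); first by rewrite normr_gt0.
  move=> v; apply: le_trans (Im_le_cn _); rewrite E.
  have ImE (s n : R) : complex.Im (s%:C - z * n%:C) = - (complex.Im z * n).
    by case: (z) => p q /=; ring.
  by rewrite ImE normrN normrM (ger0_norm (sqr_ge0 _)).
have zE : z = (complex.Re z)%:C by apply/eqP; rewrite eq_complex /= zi !eqxx.
have E2 v : `|rip (a v) v - complex.Re z * nrm v ^+ 2| <= cn (inner (a v - z *: v) v).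
  by rewrite E zE -rmorphM -rmorphB cn_real.
have [z0|z0] := ltP (complex.Re z) 0.
  apply: (aux (- complex.Re z)); first by rewrite oppr_gt0.
  move=> v; apply: le_trans (E2 v); apply: le_trans (ler_norm _).
  by rewrite mulNr lerDr positive_rip.
have [zM|zM] := ltP M (complex.Re z).
  apply: (aux (complex.Re z - M)); first by rewrite subr_gt0.
  move=> v; apply: le_trans (E2 v); rewrite distrC; apply: le_trans (ler_norm _).
  by rewrite mulrBl lerD2l lerN2 rip_positive_le.
by case: (hz (complex.Re z)) => //; rewrite z0.
Qed.

(** Over the complex numbers [Q] is a product of linear factors whose roots avoid [0, M]; the lower
    bounds of the factors multiply. *)
Lemma pev_bounded_below (Q : {poly R[i]}) : (forall t, 0 <= t <= M -> Q.[t%:C] != 0) ->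
  exists2 d : R, 0 < d & forall v, d * nrm v <= nrm (pev Q a v).
Proof.
move=> hQ; have [s Qs] := closed_field_poly_normal Q.
have lc : lead_coef Q != 0.
  rewrite lead_coef_eq0; apply: contraTneq (hQ 0 _) => [->|].
    by rewrite horner0 eqxx.
  by rewrite lexx.
have [d d0 hd] : exists2 d : R, 0 < d & forall v, d * nrm v <=
    nrm (foldr (fun z w => a w - z *: w) v s).
  have : forall z, z \in s -> forall t, 0 <= t <= M -> z <> t%:C.
    move=> z zs t ht zt; have /negP := hQ t ht; apply.
    rewrite Qs hornerZ horner_prod mulf_eq0; apply/orP; right.
    by rewrite prodf_seq_eq0; apply/hasP; exists z => //; rewrite !hornerE zt subrr eqxx.
  elim: s {Qs} => [|z s IH] hs; first by exists 1 => // v; rewrite mul1r.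
  have [d1 d10 h1] := IH (fun y ys => hs y (mem_behead (s := z :: s) ys)).
  have [d2 d20 h2] := resolvent_bounded_below (hs z (mem_head z s)).
  exists (d2 * d1); first exact: mulr_gt0.
  by move=> v /=; apply: le_trans (h2 _); rewrite -mulrA ler_pM2l.
exists (cn (lead_coef Q) * d).
  by rewrite mulr_gt0 // lt0r cn_ge0 cn_eq0 lc.
move=> v; rewrite {2}Qs pevZ nrmZ -mulrA ler_pM2l ?lt0r ?cn_ge0 ?cn_eq0 ?lc //.
by rewrite pev_prod_root.
Qed.

(* If the norm K of q(a) exceeded C then q^2 - K^2 would have no zero on [0, M], so
   that q(a)^2 - K^2 would be bounded below, whereas |(q(a)^2 - K^2) v| is small
   when |q(a) v| is close to K |v|. *)
Lemma spectral_bound (q : {poly R}) (C : R) :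
  (forall t, 0 <= t <= M -> `|q.[t]| <= C) -> op_bound (op_poly q a) C.
Proof.
move=> hq; set h := op_poly q a; have bh : bounded_op h := op_poly_bounded q pa.1.
have sh : forall u v, inner (h u) v = inner u (h v).
  by apply/op_poly_selfadjoint/positive_selfadjoint.
have C0 : 0 <= C by apply: le_trans (hq 0 _); rewrite ?lexx.
pose S := [set K : R | 0 <= K /\ forall v, nrm (h v) <= K * nrm v].
have S0 : has_inf S.
  split; last by exists 0 => K [].
  by have [K K0 hK] := bounded_opP bh; exists K.
pose K := inf S.
have K0 : 0 <= K by apply: lb_le_inf S0.1 _ => k [].
have hK v : nrm (h v) <= K * nrm v.
  apply/ler_addgt0Pl => e e0.
  have v1 : 0 < 1 + nrm v by rewrite ltr_pwDl ?ltr01 ?nrm_ge0.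
  have [k [k0 hk] kK] := inf_adherent (divr_gt0 e0 v1) S0.
  apply: le_trans (hk v) _; apply: le_trans (_ : (K + e / (1 + nrm v)) * nrm v <= _).
    by rewrite ler_wpM2r ?nrm_ge0 // ltW.
  rewrite mulrDl addrC lerD2r -mulrA ler_piMr ?(ltW e0) // mulrC ler_pdivrMr //.
  by rewrite mul1r lerDr ler01.
have [KC|CK] := leP K C.
  by apply/op_boundE => v; apply: le_trans (hK v) _; rewrite ler_wpM2r ?nrm_ge0.
have Kp : 0 < K := le_lt_trans C0 CK.
exfalso.
have [t ht|d d0 hd] := @pev_bounded_below (polyRC (q ^+ 2 - (K ^+ 2)%:P)).
  rewrite polyRC_horner !hornerE -(rmorph0 (real_complex R)) (inj_eq (@complexI R)).
  rewrite subr_eq0 -(inj_eq (@complexI R)) /= lt_eqF // ltcR -real_normK ?num_real //.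
  rewrite ltr_pXn2r ?nnegrE ?normr_ge0 ?ltW //.
  exact: le_lt_trans (hq t ht) CK.
have {}hd v : d ^+ 2 * nrm v ^+ 2 <= K ^+ 2 * (K ^+ 2 * nrm v ^+ 2 - nrm (h v) ^+ 2).
  have := hd v; rewrite -op_polyE op_polyB !fctE op_polyC expr2 op_polyM // -/h.
  move=> h1; rewrite -exprMn; apply: le_trans (_ : nrm (h (h v) - (K ^+ 2)%:C *: v) ^+ 2 <= _).
    by rewrite ler_pXn2r ?nnegrE ?nrm_ge0 // mulr_ge0 ?nrm_ge0 ?ltW.
  rewrite sqr_nrmB nrmZr ripZr /rip sh -/(rip _ _) ripvv ger0_norm ?sqr_ge0 //.
  have h2 : nrm (h (h v)) ^+ 2 <= K ^+ 2 * nrm (h v) ^+ 2.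
    by rewrite -exprMn ler_pXn2r ?nnegrE ?nrm_ge0 ?mulr_ge0 ?nrm_ge0.
  rewrite exprMn; move: h2; set p := nrm (h (h v)) ^+ 2; set r := nrm (h v) ^+ 2.
  by set n := nrm v ^+ 2; move: (K ^+ 2) => k; lra.
(* By [hd], |h v|^2 <= (K^2 - d^2 / K^2) |v|^2, which contradicts the minimality of [K]. The maximum
   with 0 gives the square root a meaning before this number is known to be nonnegative. *)
pose L := Num.sqrt (Num.max 0 (K ^+ 2 - d ^+ 2 / K ^+ 2)).
have L2 : L ^+ 2 = Num.max 0 (K ^+ 2 - d ^+ 2 / K ^+ 2).
  by rewrite sqr_sqrtr // le_max lexx.
have LS : S L.
  split=> [|v]; first exact: sqrtr_ge0.
  apply: ler_sqr_nrm; first by rewrite mulr_ge0 ?sqrtr_ge0 ?nrm_ge0.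
  rewrite exprMn L2; apply: le_trans (_ : (K ^+ 2 - d ^+ 2 / K ^+ 2) * nrm v ^+ 2 <= _).
    have := hd v; rewrite -ler_pdivrMl ?exprn_gt0 //.
    set r := nrm (h v) ^+ 2; set n := nrm v ^+ 2 => h1.
    by rewrite mulrBl [_ / _]mulrC -mulrA; lra.
  by rewrite ler_wpM2r ?sqr_ge0 // le_max lexx orbT.
have KL : K <= L by apply: ge_inf LS; exists 0 => k [].
have : K ^+ 2 <= L ^+ 2 by rewrite ler_pXn2r ?nnegrE ?sqrtr_ge0.
rewrite L2 le_max => /orP[|].
  by rewrite leNgt exprn_gt0.
by rewrite lerBrDr gerDl leNgt divr_gt0 ?exprn_gt0.
Qed.

(** If -e <= q <= B on [0, M], then |s - q| <= w there, with s and w the midpoint and the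
    half-length of [-e, B]. The spectral bound for s - q yields the lower bound s - w = -e. *)
Lemma op_poly_rip_ge (q : {poly R}) (e : R) v :
  (forall t, 0 <= t <= M -> - e <= q.[t]) ->
  - e * nrm v ^+ 2 <= rip (op_poly q a v) v.
Proof.
move=> hq.
have [B hB] : exists B : R, forall t, 0 <= t <= M -> q.[t] <= B.
  elim/poly_ind: (q) => [|r c [B hB]]; first by exists 0 => t; rewrite horner0.
  exists (`|B| * M + c) => t ht; rewrite !hornerE lerD2r.
  case/andP: (ht) => t0 tM.
  apply: le_trans (_ : `|B| * t <= _); last by rewrite ler_wpM2l.
  by rewrite ler_wpM2r //; apply: le_trans (hB t ht) (ler_norm _).
pose s := (B - e) / 2; pose w := (B + e) / 2.
have /op_boundE/(_ v) h : op_bound (op_poly (s%:P - q) a) w.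
  apply: spectral_bound => t ht; rewrite !hornerE /s /w ler_norml.
  by have := hq t ht; have := hB t ht; move=> h1 h2; apply/andP; split; lra.
have : rip (op_poly (s%:P - q) a v) v <= w * nrm v ^+ 2.
  by apply: le_trans (rip_le _ _) _; rewrite expr2 mulrA ler_wpM2r ?nrm_ge0.
rewrite op_polyB !fctE op_polyC ripDl ripNl ripZl ripvv /s /w.
set n := nrm v ^+ 2; set p := rip _ _ => h1; lra.
Qed.

End SpectralBound.

(** * Polynomial approximation *)

Section Weierstrass.
Context {R : realType}.
Implicit Types (f g : R -> R) (q : {poly R}) (M e : R).

Definition unif_cont_on M f := forall e, 0 < e -> exists2 d : R, 0 < d &
  forall s t : R, 0 <= s <= M -> 0 <= t <= M -> `|s - t| <= d -> `|f s - f t| <= e.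

Definition bounded_fun_on M f := exists2 K : R, 0 <= K & forall t : R, 0 <= t <= M -> `|f t| <= K.

(** Continuity on [0, M] in the quantitative form that the Bernstein estimate consumes: a modulus
    for near points and a bound for distant ones. *)
Definition nice_on M f := unif_cont_on M f /\ bounded_fun_on M f.

(* The value of [bernstein n g] at [t] is the mean of [g] under the binomial
   distribution with parameters [n] and [t]. *)
Fixpoint bernstein n (g : nat -> R) : {poly R} :=
  if n is n'.+1 then (1 - 'X) * bernstein n' g + 'X * bernstein n' (g \o S)
  else (g 0)%:P.

Lemma bernsteinS n (g : nat -> R) t : (bernstein n.+1 g).[t] =
  (1 - t) * (bernstein n g).[t] + t * (bernstein n (g \o S)).[t].
Proof. by rewrite /= !hornerE. Qed.

Lemma bernstein_lin n (c : R) (g h : nat -> R) t :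
  (bernstein n (fun k => c * g k + h k)).[t] =
  c * (bernstein n g).[t] + (bernstein n h).[t].
Proof.
elim: n g h => [|n IH] g h; first by rewrite /= !hornerE.
rewrite !bernsteinS IH.
have -> : (fun k => c * g k + h k) \o S = (fun k => c * (g \o S) k + (h \o S) k) by [].
by rewrite IH; ring.
Qed.

Lemma bernstein_cst n (c t : R) : (bernstein n (fun=> c)).[t] = c.
Proof.
elim: n => [|n IH]; first by rewrite /= !hornerE.
by rewrite bernsteinS !IH; ring.
Qed.

Lemma bernstein_le n (g h : nat -> R) t : 0 <= t <= 1 ->
  (forall k, (k <= n)%N -> g k <= h k) -> (bernstein n g).[t] <= (bernstein n h).[t].
Proof.
case/andP=> t0 t1; elim: n g h => [|n IH] g h gh; first by rewrite /= !hornerE gh.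
rewrite !bernsteinS lerD // ler_wpM2l ?subr_ge0 //; apply: IH => k kn; apply: gh => //.
exact: leqW.
Qed.

(** The centre [c] is arbitrary because the recursion shifts it by one; at [c = n t] only the
    variance n t (1 - t) remains. *)
Lemma bernstein_variance n (c t : R) : (bernstein n (fun k => (k%:R - c) ^+ 2)).[t] =
  (n%:R * t - c) ^+ 2 + n%:R * (t * (1 - t)).
Proof.
elim: n c => [|n IH] c; first by rewrite /= !hornerE; ring.
rewrite bernsteinS IH.
have -> : (fun k : nat => (k%:R - c) ^+ 2) \o S = (fun k : nat => (k%:R - (c - 1)) ^+ 2).
  by apply/funext => k /=; rewrite -natr1; ring.
by rewrite IH -natr1; ring.
Qed.

Lemma bernstein_approx f : nice_on 1 f -> forall e, 0 < e ->
  exists q, forall t : R, 0 <= t <= 1 -> `|q.[t] - f t| <= e.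
Proof.
move=> [uf [K K0 hK]] e e0; have [d d0 hd] := uf _ (divr_gt0 e0 (ltr0Sn R 1)).
(* Chebyshev's inequality: where |k/n - t| > d, the values of [f] differ by at most 2 K <= A (k/n -
   t)^2, and the mean of that square is t (1 - t) / n. The choice of [n] makes A / n at most e /
   2. *)
pose A := 2 * K / d ^+ 2; have A0 : 0 <= A by rewrite /A divr_ge0 ?mulr_ge0 ?exprn_ge0 ?(ltW d0).
pose n := (Num.truncn (A * 2 / e)).+1.
have n0 : 0 < n%:R :> R by rewrite ltr0Sn.
have An : A / n%:R <= e / 2.
  rewrite ler_pdivrMr // mulrC -ler_pdivrMr ?divr_gt0 // invf_div mulrA.
  by apply: ltW; apply: truncnS_gt.
exists (bernstein n (fun k => f (k%:R / n%:R))) => t ht.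
pose g k := A / n%:R ^+ 2 * (k%:R - n%:R * t) ^+ 2 + e / 2.
have hg k : (k <= n)%N -> `|f (k%:R / n%:R) - f t| <= g k.
  move=> kn; have hk : 0 <= (k%:R / n%:R : R) <= 1.
    by rewrite divr_ge0 ?ler0n //= ler_pdivrMr // mul1r ler_nat.
  have gE : g k = A * (k%:R / n%:R - t) ^+ 2 + e / 2.
    by rewrite /g; congr (_ + _); field; rewrite gt_eqF.
  have [h|h] := leP `|k%:R / n%:R - t| d.
    apply: le_trans (hd _ _ hk ht h) _; rewrite gE lerDr.
    by rewrite mulr_ge0 ?sqr_ge0.
  apply: le_trans (ler_normB _ _) _.
  apply: le_trans (_ : 2 * K <= _).
    by have := hK _ hk; have := hK _ ht; set x := `|_|; set y := `|_|; lra.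
  rewrite gE; apply: ler_wpDr; first by rewrite ltW ?divr_gt0.
  have -> : A * (k%:R / n%:R - t) ^+ 2 = 2 * K * ((k%:R / n%:R - t) ^+ 2 / d ^+ 2).
    by rewrite /A [RHS]mulrA [RHS]mulrAC.
  apply: ler_peMr; rewrite ?mulr_ge0 // ler_pdivlMr ?exprn_gt0 // mul1r.
  by rewrite -[leRHS]real_normK ?num_real // ler_pXn2r ?nnegrE ?normr_ge0 ?ltW.
have Eg : (bernstein n g).[t] <= e.
  rewrite /g (bernstein_lin n _ (fun k => (k%:R - n%:R * t) ^+ 2) (fun=> e / 2)).
  rewrite bernstein_cst bernstein_variance subrr expr0n add0r.
  have -> : A / n%:R ^+ 2 * (n%:R * (t * (1 - t))) = (t * (1 - t)) * (A / n%:R).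
    by field; rewrite gt_eqF.
  apply: le_trans (_ : 1 * (A / n%:R) + e / 2 <= _); last by lra.
  rewrite lerD2r; apply: (ler_wpM2r (divr_ge0 A0 (ltW n0))).
  by case/andP: ht => t0 t1; rewrite mulr_ile1 ?subr_ge0 // gerBl.
have lo : (bernstein n (fun k => -1 * g k + f t)).[t] <= (bernstein n (fun k => f (k%:R / n%:R))).[t].
  by apply: bernstein_le => // k kn; have := hg k kn; rewrite ler_norml => /andP[h _]; lra.
have hi : (bernstein n (fun k => f (k%:R / n%:R))).[t] <= (bernstein n (fun k => 1 * g k + f t)).[t].
  by apply: bernstein_le => // k kn; have := hg k kn; rewrite ler_norml => /andP[_ h]; lra.
move: lo hi; rewrite !(bernstein_lin n _ g (fun=> f t)) !bernstein_cst => lo hi.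
by rewrite ler_norml; apply/andP; split; lra.
Qed.

Lemma weierstrass M f : 0 <= M -> nice_on M f -> forall e, 0 < e ->
  exists q, forall t : R, 0 <= t <= M -> `|q.[t] - f t| <= e.
Proof.
rewrite le_eqVlt => /orP[/eqP <- _ e e0|M0].
  exists (f 0)%:P => t; rewrite -eq_le => /eqP <-.
  by rewrite hornerC subrr normr0 ltW.
move=> [uf [K K0 hK]] e e0.
have scale t : 0 <= t <= 1 -> 0 <= M * t <= M.
  by case/andP=> t0 t1; rewrite mulr_ge0 ?(ltW M0) //= ger_pMr.
have [|q hq] := @bernstein_approx (fun t => f (M * t)) _ _ e0.
  split; last by exists K => // t /scale; apply: hK.
  move=> e' e'0; have [d d0 hd] := uf _ e'0; exists (d / M); first exact: divr_gt0.
  move=> s t /scale hs /scale ht st; apply: hd => //.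
  by rewrite -mulrBr normrM gtr0_norm // mulrC -ler_pdivlMr.
exists (q \Po (M^-1 *: 'X)) => t /andP[t0 tM].
rewrite horner_comp !hornerE.
have := hq (M^-1 * t); rewrite mulVKf ?gt_eqF //; apply.
by rewrite mulr_ge0 ?invr_ge0 ?(ltW M0) //= mulrC ler_pdivrMr // mul1r.
Qed.

Lemma nice_on_mul M f g : nice_on M f -> nice_on M g -> nice_on M (fun t => f t * g t).
Proof.
move=> [uf [K K0 hK]] [ug [L L0 hL]]; split; last first.
  exists (K * L); first exact: mulr_ge0.
  by move=> t ht; rewrite normrM ler_pM ?hK ?hL.
have KL : 0 < 1 + K + L by lra.
move=> e e0; have e'0 := divr_gt0 e0 KL.
have [d d0 hd] := uf _ e'0; have [d' d'0 hd'] := ug _ e'0.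
exists (Num.min d d'); first by rewrite lt_min d0.
move=> s t hs ht; rewrite le_min => /andP[st st'].
have -> : f s * g s - f t * g t = (f s - f t) * g s + f t * (g s - g t) by ring.
apply: le_trans (ler_normD _ _) _; rewrite !normrM.
apply: le_trans (_ : e / (1 + K + L) * L + K * (e / (1 + K + L)) <= _).
  by rewrite lerD // ler_pM ?hd ?hd' ?hL ?hK.
rewrite [K * _]mulrC -mulrDr -mulrA ger_pMr // mulrC ler_pdivrMr //; lra.
Qed.

Lemma nice_on_max_sub M f c : nice_on M f -> nice_on M (fun t => Num.max (f t - c) 0).
Proof.
move=> [uf [K K0 hK]]; split; last first.
  exists (K + `|c|); first by rewrite addr_ge0.
  move=> t ht; rewrite ger0_norm; last by rewrite le_max lexx orbT.
  rewrite ge_max addr_ge0 // andbT.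
  apply: le_trans (ler_norm _) _; apply: le_trans (ler_normB _ _) _.
  by rewrite lerD2r hK.
move=> e e0; have [d d0 hd] := uf e e0; exists d => // s t hs ht /(hd _ _ hs ht).
rewrite !ler_norml => /andP[h1 h2]; rewrite /Num.max.
by case: ltP => h3; case: ltP => h4; apply/andP; split; lra.
Qed.

(** A ratio r in [0, 1] satisfies r <= r^p when p <= 1; this is applied to x / (x + y) and y / (x +
    y), whose sum is 1. *)
Lemma powR_subadd (x y p : R) : 0 <= x -> 0 <= y -> 0 < p <= 1 ->
  (x + y) `^ p <= x `^ p + y `^ p.
Proof.
move=> x0 y0 /andP[p0 p1]; have := addr_ge0 x0 y0; rewrite le_eqVlt => /orP[/eqP <-|s0].
  by rewrite powR0 ?gt_eqF // addr_ge0 ?powR_ge0.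
have aux z : 0 <= z <= x + y -> z / (x + y) * (x + y) `^ p <= z `^ p.
  move=> /andP[z0 zs].
  have r01 : 0 <= z / (x + y) <= 1 by rewrite divr_ge0 ?(ltW s0) //= ler_pdivrMr // mul1r.
  have {2}-> : z = z / (x + y) * (x + y) by rewrite divfK // gt_eqF.
  case/andP: r01 => r0 r1; rewrite powRM ?(ltW s0) // ler_wpM2r ?powR_ge0 //.
  have := r0; rewrite le_eqVlt => /orP[/eqP <-|rp]; first by rewrite powR_ge0.
  by rewrite -[leLHS]powRr1 // ger_powR // rp.
have h1 := aux x; have h2 := aux y.
apply: le_trans (lerD (h1 _) (h2 _)); rewrite ?x0 ?y0 ?lerDl ?lerDr //.
by rewrite -mulrDl -mulrDl divff ?mul1r // gt_eqF.
Qed.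

(** Subadditivity gives |t^p - s^p| <= |t - s|^p, so that e^(1/p) is a modulus of continuity. *)
Lemma nice_on_powR_le1 M p : 0 < p <= 1 -> nice_on M (fun t => t `^ p).
Proof.
move=> p01; have p0 : 0 < p by case/andP: p01.
split; last first.
  exists (M `^ p) => [|t /andP[t0 tM]]; first exact: powR_ge0.
  by rewrite ger0_norm ?powR_ge0 // ge0_ler_powR ?nnegrE ?(ltW p0) // (le_trans t0).
have key s t : 0 <= s -> s <= t -> `|t `^ p - s `^ p| <= (t - s) `^ p.
  move=> s0 st; rewrite ger0_norm; last first.
    by rewrite subr_ge0 ge0_ler_powR ?nnegrE ?(ltW p0) // (le_trans s0).
  rewrite lerBlDr -{1}(subrK s t) powR_subadd //.
  by rewrite subr_ge0.
move=> e e0; exists (e `^ p^-1); first exact: powR_gt0.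
have hp z : 0 <= z -> z <= e `^ p^-1 -> z `^ p <= e.
  move=> z0 ze; apply: le_trans (_ : (e `^ p^-1) `^ p <= _).
    by rewrite ge0_ler_powR ?nnegrE ?(ltW p0) ?powR_ge0.
  by rewrite -powRrM mulVf ?gt_eqF // powRr1 // ltW.
move=> s t /andP[s0 _] /andP[t0 _]; have [st|/ltW ts] := leP s t.
  rewrite [X in X <= _ -> _]distrC ger0_norm ?subr_ge0 // => h.
  by rewrite distrC; apply: le_trans (key _ _ s0 st) _; rewrite hp ?subr_ge0.
rewrite ger0_norm ?subr_ge0 // => h.
by apply: le_trans (key _ _ t0 ts) _; rewrite hp ?subr_ge0.
Qed.

(** With n > p the exponent p / n is at most 1, and t^p is the n-th power of t^(p/n). *)
Lemma nice_on_powR M p : 0 < p -> nice_on M (fun t => t `^ p).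
Proof.
move=> p0; pose n := (Num.truncn p).+1.
have n0 : 0 < n%:R :> R by rewrite ltr0Sn.
have q01 : 0 < p / n%:R <= 1.
  by rewrite divr_gt0 //= ler_pdivrMr // mul1r ltW // truncnS_gt.
have h k : nice_on M (fun t => (t `^ (p / n%:R)) `^ k.+1%:R).
  elim: k => [|k IH].
    suff -> : (fun t => (t `^ (p / n%:R)) `^ 1%:R) = (fun t => t `^ (p / n%:R)).
      exact: nice_on_powR_le1.
    by apply/funext => t; rewrite powRr1 ?powR_ge0.
  suff -> : (fun t => (t `^ (p / n%:R)) `^ k.+2%:R) =
    (fun t => t `^ (p / n%:R) * (t `^ (p / n%:R)) `^ k.+1%:R).
    exact: nice_on_mul (nice_on_powR_le1 _ q01) IH.
  by apply/funext => t; rewrite !powR_mulrn ?powR_ge0 // exprS.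
suff -> : (fun t => t `^ p) = (fun t => (t `^ (p / n%:R)) `^ n%:R) by apply: h.
by apply/funext => t; rewrite -powRrM divfK // gt_eqF.
Qed.

Lemma sqr_powR_half (t : R) : 0 <= t -> t `^ 2^-1 * t `^ 2^-1 = t.
Proof. by move=> t0; rewrite powR12_sqrt // -expr2 sqr_sqrtr. Qed.

End Weierstrass.

(** * Continuous functional calculus and the modulus *)

Section FunctionalCalculus.
Context {R : realType} {H : hilbertType R}.
Implicit Types (u v w : H) (r e M : R) (x y a b c : H -> H) (f g : R -> R).

(** The relation behind [cfc] with the interval made explicit; one polynomial per tolerance, close
    to both [f] and [b], is easier to combine than a sequence. *)
Definition is_cfc M f a b := forall e, 0 < e -> exists q : {poly R},
  (forall t, 0 <= t <= M -> `|q.[t] - f t| <= e) /\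
  forall v, nrm (op_poly q a v - b v) <= e * nrm v.

Lemma invS_small e : 0 < e -> exists N : nat, forall n, (N <= n)%N -> n.+1%:R^-1 <= e.
Proof.
move=> e0; exists (Num.truncn e^-1) => n Nn.
rewrite invf_ple ?posrE ?ltr0Sn //.
by apply: ltW; apply: lt_le_trans (truncnS_gt _) _; rewrite ler_nat ltnS.
Qed.

Section Calculus.
Variables (a : H -> H) (M : R).
Hypothesis pa : positive_op a.
Hypothesis aM : op_bound a M.
Hypothesis M0 : 0 <= M.

Let la : linear a := pa.1.1.

Lemma is_cfc_exists f : nice_on M f -> exists2 b, bounded_op b & is_cfc M f a b.
Proof.
move=> nf; have i0 n : (0 : R) < n.+1%:R^-1 by rewrite invr_gt0 ltr0Sn.
have [q hq] := choice (fun n => weierstrass M0 nf (i0 n)).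
have qB n m v : nrm (op_poly (q n) a v - op_poly (q m) a v) <=
    (n.+1%:R^-1 + m.+1%:R^-1) * nrm v.
  have /op_boundE/(_ v) : op_bound (op_poly (q n - q m) a) (n.+1%:R^-1 + m.+1%:R^-1).
    apply: spectral_bound => // t ht; rewrite !hornerE.
    have -> : (q n).[t] - (q m).[t] = ((q n).[t] - f t) - ((q m).[t] - f t) by ring.
    by apply: le_trans (ler_normB _ _) _; rewrite lerD // hq.
  by rewrite op_polyB !fctE.
have hb v : exists bv, forall e, 0 < e -> exists N, forall n, (N <= n)%N ->
    nrm (bv - op_poly (q n) a v) <= e.
  apply: nrm_complete => e e0.
  have v1 : 0 < 2 * (1 + nrm v) by rewrite mulr_gt0 // ltr_pwDl ?ltr01 ?nrm_ge0.
  have [N hN] := invS_small (divr_gt0 e0 v1); exists N => n m Nn Nm.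
  apply: le_trans (qB _ _ _) _.
  apply: le_trans (_ : (e / (2 * (1 + nrm v)) *+ 2) * nrm v <= _).
    by rewrite ler_wpM2r ?nrm_ge0 // mulr2n lerD ?hN.
  have -> : e / (2 * (1 + nrm v)) *+ 2 * nrm v = e * (nrm v / (1 + nrm v)).
    by field; rewrite gt_eqF // ltr_pwDl ?ltr01 ?nrm_ge0.
  rewrite ler_piMr ?(ltW e0) // ler_pdivrMr ?mul1r ?lerDr ?ler01 //.
  by rewrite ltr_pwDl ?ltr01 ?nrm_ge0.
have [b bE] := choice hb.
(* [b v] was obtained separately for each [v]; comparing [q n] with a later [q m] recovers a rate
   uniform in [v], that is, convergence in operator norm. *)
have bq n v : nrm (op_poly (q n) a v - b v) <= (2 * n.+1%:R^-1) * nrm v.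
  apply/ler_addgt0Pl => e e0; have [N hN] := bE v e e0.
  pose m := maxn n N.
  have -> : op_poly (q n) a v - b v =
      (op_poly (q m) a v - b v) + (op_poly (q n) a v - op_poly (q m) a v).
    by rewrite [RHS]addrC addrA subrK.
  apply: le_trans (nrmD _ _) _; rewrite lerD //.
    by rewrite nrmB hN // leq_maxr.
  apply: le_trans (qB _ _ _) _; rewrite ler_wpM2r ?nrm_ge0 // mulr_natl mulr2n lerD2l.
  by rewrite lef_pV2 ?posrE ?ltr0Sn // ler_nat ltnS leq_maxl.
have bS e : 0 < e -> exists n, forall v, nrm (op_poly (q n) a v - b v) <= e * nrm v.
  move=> e0; have [N hN] := invS_small (divr_gt0 e0 (ltr0Sn R 1)).
  exists N => v; apply: le_trans (bq _ _) _; rewrite ler_wpM2r ?nrm_ge0 //.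
  by have := hN N (leqnn _); move: (N.+1%:R^-1) => z; lra.
exists b; last first.
  move=> e e0; have [N hN] := invS_small (divr_gt0 e0 (ltr0Sn R 1)).
  exists (q N); split=> [t ht|v].
    apply: le_trans (hq N t ht) _; apply: le_trans (hN N (leqnn _)) _.
    by rewrite ler_pdivrMr // ler_peMr ?(ltW e0) // ler1n.
  apply: le_trans (bq _ _) _; rewrite ler_wpM2r ?nrm_ge0 //.
  by have := hN N (leqnn _); move: (N.+1%:R^-1) => z; lra.
split.
  move=> d u v; apply/eqP; rewrite -subr_eq0; apply/eqP.
  apply: (nrm_small (K := nrm (d *: u + v) + (cn d * nrm u + nrm v))) => e e0.
  have [n hn] := bS e e0; have lq := (op_poly_bounded (q n) pa.1).1.
  pose D w := op_poly (q n) a w - b w.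
  have bD w : b w = op_poly (q n) a w - D w by rewrite /D opprB addrC subrK.
  have -> : b (d *: u + v) - (d *: b u + b v) = d *: D u + D v - D (d *: u + v).
    rewrite !bD lq scalerBr; set A := d *: op_poly _ _ _; set B := op_poly _ _ _.
    rewrite [A - _ + _]addrACA -opprD.
    have aux (p r z : H) : p - r - (p - z) = z - r by rewrite opprB addrC addrA subrK.
    exact: aux.
  rewrite mulrDr addrC; apply: le_trans (nrmD _ _) _; rewrite nrmN lerD ?hn //.
  rewrite mulrDr; apply: le_trans (nrmD _ _) _; rewrite lerD ?hn // nrmZ mulrCA.
  by rewrite ler_wpM2l ?cn_ge0 ?hn.
have [n hn] := bS 1 ltr01; have [B B0 hB] := bounded_opP (op_poly_bounded (q n) pa.1).
exists (1 + B); apply/op_boundE => v.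
have -> : b v = - (op_poly (q n) a v - b v) + op_poly (q n) a v by rewrite opprB subrK.
by apply: le_trans (nrmD _ _) _; rewrite nrmN mulrDl lerD.
Qed.

Lemma is_cfc_uniq f b b' : is_cfc M f a b -> is_cfc M f a b' -> b = b'.
Proof.
move=> hb hb'; apply/funext => v; apply/eqP; rewrite -subr_eq0; apply/eqP.
apply: (nrm_small (K := 4 * nrm v)) => e e0.
have [q [qf qb]] := hb e e0; have [q' [qf' qb']] := hb' e e0.
have /op_boundE/(_ v) : op_bound (op_poly (q - q') a) (e *+ 2).
  apply: spectral_bound => // t ht; rewrite !hornerE.
  have -> : q.[t] - q'.[t] = (q.[t] - f t) - (q'.[t] - f t) by ring.
  by apply: le_trans (ler_normB _ _) _; rewrite mulr2n lerD ?qf ?qf'.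
rewrite op_polyB !fctE => h.
have -> : b v - b' v = - (op_poly q a v - b v) + (op_poly q a v - op_poly q' a v)
    + (op_poly q' a v - b' v).
  by rewrite opprB !subrKA.
have -> : e * (4 * nrm v) = e * nrm v + e *+ 2 * nrm v + e * nrm v by ring.
apply: le_trans (nrmD _ _) _; rewrite lerD //.
by apply: le_trans (nrmD _ _) _; rewrite nrmN lerD.
Qed.

Lemma is_cfc_poly (q : {poly R}) : is_cfc M (fun t => q.[t]) a (op_poly q a).
Proof.
move=> e e0; exists q; split=> [t _|v]; first by rewrite subrr normr0 ltW.
by rewrite subrr nrm0 mulr_ge0 ?nrm_ge0 ?ltW.
Qed.

Lemma is_cfc_cst (k : R) : is_cfc M (fun=> k) a (k%:C *: id).
Proof.
have := is_cfc_poly k%:P; congr (is_cfc _ _ _ _).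
  by apply/funext => t; rewrite hornerC.
by apply/funext => v; rewrite op_polyC fctE.
Qed.

Lemma is_cfc_lin (k : R) f g b c : is_cfc M f a b -> is_cfc M g a c ->
  is_cfc M (fun t => k * f t + g t) a (k%:C *: b + c).
Proof.
move=> hb hc e e0; have k1 : 0 < 1 + `|k| by rewrite ltr_pwDl.
have [q [qf qb]] := hb _ (divr_gt0 e0 k1).
have [q' [qg qc]] := hc _ (divr_gt0 e0 k1).
have eE : e = `|k| * (e / (1 + `|k|)) + e / (1 + `|k|) by field; rewrite gt_eqF.
exists (k *: q + q'); split=> [t ht|v].
  rewrite !hornerE.
  have -> : k * q.[t] + q'.[t] - (k * f t + g t) = k * (q.[t] - f t) + (q'.[t] - g t) by ring.
  rewrite eE; apply: le_trans (ler_normD _ _) _; rewrite normrM.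
  by rewrite lerD ?qg // ler_wpM2l ?qf.
rewrite op_polyD op_polyZ !fctE opprD addrACA -scalerBr.
rewrite {1}eE mulrDl -(mulrA `|k|); apply: le_trans (nrmD _ _) _; rewrite nrmZr.
by rewrite lerD ?qc // ler_wpM2l ?qb.
Qed.

Lemma is_cfc_mul f g b c : bounded_fun_on M f -> bounded_fun_on M g ->
  bounded_op b -> bounded_op c -> is_cfc M f a b -> is_cfc M g a c ->
  is_cfc M (fun t => f t * g t) a (b \o c).
Proof.
move=> [K K0 hK] [L L0 hL] bb bc hb hc e e0.
have [C C0 hC] := bounded_opP bc.
(* The errors are (K + d) d + d L for the functions and (K + d) d + d C for the operators, since |q|
   <= K + d also bounds q(a); as d <= 1, both are at most k d. *)
pose k := 1 + K + L + C + 1; have k0 : 0 < k by rewrite /k; lra.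
pose d := Num.min 1 (e / k).
have d0 : 0 < d by rewrite lt_min ltr01 divr_gt0.
have d1 : d <= 1 by rewrite ge_min lexx.
have dk : d * k <= e by rewrite -ler_pdivlMr // ge_min lexx orbT.
have [q [qf qb]] := hb _ d0; have [q' [qg qc]] := hc _ d0.
have qK t : 0 <= t <= M -> `|q.[t]| <= K + d.
  move=> ht; have -> : q.[t] = f t + (q.[t] - f t) by ring.
  by apply: le_trans (ler_normD _ _) _; rewrite lerD ?hK ?qf.
have qdk : (K + d) * d <= e - (L + C) * d.
  have : (1 + K + L + C + 1) * d <= e by rewrite mulrC.
  have : d * d <= d by rewrite ler_piMr ?(ltW d0).
  lra.
exists (q * q'); split=> [t ht|v].
  rewrite hornerM.
  have -> : q.[t] * q'.[t] - f t * g t = q.[t] * (q'.[t] - g t) + (q.[t] - f t) * g t by ring.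
  apply: le_trans (ler_normD _ _) _; rewrite !normrM.
  apply: le_trans (_ : (K + d) * d + d * L <= _).
    by rewrite lerD // ler_pM ?qK ?qg ?qf ?hL.
  have : 0 <= C * d by rewrite mulr_ge0 // ltW.
  lra.
rewrite op_polyM //.
have -> : op_poly q a (op_poly q' a v) - (b \o c) v =
   op_poly q a (op_poly q' a v - c v) + (op_poly q a (c v) - b (c v)).
  by rewrite (linB (op_poly_bounded q pa.1).1) addrA subrK.
apply: le_trans (nrmD _ _) _.
apply: le_trans (_ : (K + d) * (d * nrm v) + d * (C * nrm v) <= _).
  rewrite lerD //.
    have /op_boundE/(_ (op_poly q' a v - c v)) h := spectral_bound pa aM M0 qK.
    by apply: le_trans h _; rewrite ler_wpM2l ?qc // addr_ge0 // ltW.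
  by apply: le_trans (qb _) _; rewrite ler_wpM2l ?hC // ltW.
rewrite !mulrA -mulrDl ler_wpM2r ?nrm_ge0 //.
have : 0 <= L * d by rewrite mulr_ge0 // ltW.
lra.
Qed.

Lemma is_cfc_positive f b : bounded_op b -> is_cfc M f a b ->
  (forall t, 0 <= t <= M -> 0 <= f t) -> positive_op b.
Proof.
move=> bb hb f0; apply: selfadjoint_positive => //.
  move=> u v; apply/eqP; rewrite -subr_eq0 -cn_eq0 eq_le cn_ge0 andbT.
  apply/ler_addgt0Pl => e e0; rewrite addr0.
  have k0 : 0 < 1 + nrm u * nrm v by rewrite ltr_pwDl ?mulr_ge0 ?nrm_ge0.
  have [q [_ qb]] := hb _ (divr_gt0 (divr_gt0 e0 (ltr0Sn R 1)) k0).
  have sq := op_poly_selfadjoint q (positive_selfadjoint pa).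
  have -> : inner (b u) v - inner u (b v) =
     - inner (op_poly q a u - b u) v + inner u (op_poly q a v - b v).
    by rewrite !(innerDl, innerDr, innerNl, innerNr) sq opprB addrA subrK.
  apply: le_trans (cnD _ _) _.
  have -> : cn (- inner (op_poly q a u - b u) v) = cn (inner (op_poly q a u - b u) v).
    by rewrite /cn normrN.
  set E := e / _ / _ in qb.
  have hE : E * (nrm u * nrm v) <= e / 2.
    rewrite /E mulrAC ler_pdivrMr // ler_wpM2l ?divr_ge0 ?(ltW e0) //.
    by rewrite lerDr ler01.
  have h1 : cn (inner (op_poly q a u - b u) v) <= E * (nrm u * nrm v).
    apply: le_trans (cauchy_schwarz _ _) _.
    by rewrite mulrA ler_wpM2r ?nrm_ge0.
  have h2 : cn (inner u (op_poly q a v - b v)) <= E * (nrm u * nrm v).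
    apply: le_trans (cauchy_schwarz _ _) _.
    by rewrite mulrCA ler_wpM2l ?nrm_ge0.
  lra.
move=> v; rewrite -oppr_le0; apply/ler_addgt0Pl => e e0; rewrite addr0.
have k0 : 0 < 1 + nrm v ^+ 2 by rewrite ltr_pwDl ?sqr_ge0.
have [q [qf qb]] := hb _ (divr_gt0 (divr_gt0 e0 (ltr0Sn R 1)) k0).
set E := e / _ / _ in qf qb.
have hE : E * nrm v ^+ 2 <= e / 2.
  rewrite /E mulrAC ler_pdivrMr // ler_wpM2l ?divr_ge0 ?(ltW e0) //.
  by rewrite lerDr ler01.
have h1 : - E * nrm v ^+ 2 <= rip (op_poly q a v) v.
  apply: op_poly_rip_ge => // t ht.
  have := qf t ht; rewrite ler_norml => /andP[h _]; have := f0 t ht; lra.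
have h2 : rip (op_poly q a v - b v) v <= E * nrm v ^+ 2.
  apply: le_trans (rip_le _ _) _.
  by rewrite expr2 mulrA ler_wpM2r ?nrm_ge0.
move: h2; rewrite ripDl ripNl; lra.
Qed.

Lemma is_cfc_comm f b y : is_cfc M f a b -> bounded_op y ->
  (forall v, y (a v) = a (y v)) -> forall v, y (b v) = b (y v).
Proof.
move=> hb bY ya v; have [C C0 hC] := bounded_opP bY.
apply/eqP; rewrite -subr_eq0; apply/eqP.
apply: (nrm_small (K := 2 * (C * nrm v))) => e e0.
have [q [_ qb]] := hb e e0.
have -> : y (b v) - b (y v) = - y (op_poly q a v - b v) + (op_poly q a (y v) - b (y v)).
  by rewrite (linB bY.1) (op_poly_comm q v la bY.1 ya) opprB addrA subrK.
apply: le_trans (nrmD _ _) _; rewrite nrmN.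
have -> : e * (2 * (C * nrm v)) = C * (e * nrm v) + e * (C * nrm v) by ring.
rewrite lerD //; first by apply: le_trans (hC _) _; rewrite ler_wpM2l.
by apply: le_trans (qb _) _; rewrite ler_wpM2l ?hC // ltW.
Qed.

Lemma is_cfc_ker f b v : is_cfc M f a b -> f 0 = 0 -> a v = 0 -> b v = 0.
Proof.
move=> hb f0 av; apply: (nrm_small (K := 2 * nrm v)) => e e0.
have [q [qf qb]] := hb e e0.
have avE : a v = (0 : R)%:C *: v by rewrite av scale0r.
have := qb v; rewrite (op_poly_eigen q la avE) => h.
have -> : b v = - ((q.[0])%:C *: v - b v) + (q.[0])%:C *: v by rewrite opprB subrK.
apply: le_trans (nrmD _ _) _; rewrite nrmN nrmZr.
have := qf 0; rewrite lexx M0 f0 subr0 => /(_ isT) h2.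
have -> : e * (2 * nrm v) = e * nrm v + e * nrm v by ring.
by rewrite lerD // ler_wpM2r ?nrm_ge0.
Qed.

End Calculus.

Lemma is_cfc_restrict M M' f a b : M' <= M -> is_cfc M f a b -> is_cfc M' f a b.
Proof.
move=> MM hb e e0; have [q [qf qb]] := hb e e0; exists q; split=> // t /andP[t0 tM].
by rewrite qf // t0 (le_trans tM).
Qed.

Lemma cfcE M f a b : positive_op a -> op_bound a M -> 0 <= M ->
  bounded_op b -> is_cfc M f a b -> cfc f a = b.
Proof.
move=> pa aM M0 bb hb; rewrite /cfc; case: xgetP => [b' _ [bb' [M' [q [aM' qf qb]]]]|].
  have hb' : is_cfc M' f a b'.
    move=> e e0; have [N1 _ h1] := qf e e0; have [N2 _ h2] := qb e e0.
    exists (q (maxn N1 N2)); split; first by apply: h1; rewrite /= leq_maxl.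
    by have /op_boundE := h2 (maxn N1 N2) (leq_maxr _ _).
  (* A negative bound for [a] is possible only if [H] is trivial; for M' >= 0 both relations
     restrict to [0, min(M, M')]. *)
  have [M'0|M'0] := ltP M' 0.
    have n0 v : v = 0.
      apply/eqP; rewrite -nrm_eq0 eq_le nrm_ge0 andbT -(ler_nM2l M'0) mulr0.
      have /op_boundE := aM' => /(_ v); exact: le_trans (nrm_ge0 _).
    by apply/funext => v; rewrite [LHS]n0 [RHS]n0.
  pose m := Num.min M M'.
  have m0 : 0 <= m by rewrite le_min M0.
  have am : op_bound a m by rewrite /m /Num.min; case: ifP.
  apply: (is_cfc_uniq (f := f) pa am m0).
    by apply: is_cfc_restrict hb'; rewrite ge_min lexx orbT.
  by apply: is_cfc_restrict hb; rewrite ge_min lexx.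
move=> /(_ b); case; split => //; exists M.
have i0 n : (0 : R) < n.+1%:R^-1 by rewrite invr_gt0 ltr0Sn.
have [q hq] := choice (fun n => hb _ (i0 n)).
exists q; split=> // e e0; have [N hN] := invS_small e0; exists N => // n /= Nn.
  by move=> t /(hq n).1 h; apply: le_trans h _; apply: hN.
apply/op_boundE => v; rewrite !fctE; apply: le_trans ((hq n).2 v) _.
by rewrite ler_wpM2r ?nrm_ge0 ?hN.
Qed.

Lemma op_poly_comp_sqr (q : {poly R}) a : linear a ->
  op_poly (q \Po 'X^2) a = op_poly q (a \o a).
Proof.
move=> la; have laa : linear (a \o a) := lin_comp la la.
apply/funext; elim/poly_ind: q => [|q c IH] v.
  by rewrite comp_poly0 -polyC0 !op_polyC.
rewrite comp_polyD comp_polyC comp_polyM comp_polyX !op_polyD !fctE !op_polyC.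
by rewrite expr2 !op_polyM // IH !op_polyX.
Qed.

Lemma sqrt_op_exists a : positive_op a ->
  exists2 s, positive_op s & s \o s = a.
Proof.
move=> pa; have [M M0 /op_boundE aM] := bounded_opP pa.1.
have nf : nice_on M (fun t => t `^ 2^-1) by apply: nice_on_powR; rewrite invr_gt0.
have [s bs hs] := is_cfc_exists pa aM M0 nf; exists s.
  by apply: (is_cfc_positive pa aM M0 bs hs) => t _; apply: powR_ge0.
have h := is_cfc_mul pa aM M0 nf.2 nf.2 bs bs hs hs.
apply: (is_cfc_uniq pa aM M0 h) => e e0.
exists 'X; split => [t /andP[t0 _]|v].
  by rewrite sqr_powR_half // hornerX subrr normr0 ltW.
by rewrite op_polyX subrr nrm0 mulr_ge0 ?nrm_ge0 ?ltW.
Qed.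

(* A positive s is recovered from s^2 as the limit of r(s^2), for polynomials r
   tending to the square root. *)
Lemma sqrt_op_uniq (s s' : H -> H) : positive_op s -> positive_op s' -> s \o s = s' \o s' -> s = s'.
Proof.
move=> ps ps' ss; have [M M0 hM] := bounded_opP ps.1; have [L L0 hL] := bounded_opP ps'.1.
pose m := M + L; have m0 : 0 <= m by rewrite addr_ge0.
have sm : op_bound s m.
  by apply/op_boundE => v; apply: le_trans (hM v) _; rewrite ler_wpM2r ?nrm_ge0 ?lerDl.
have sm' : op_bound s' m.
  by apply/op_boundE => v; apply: le_trans (hL v) _; rewrite ler_wpM2r ?nrm_ge0 ?lerDr.
have nf : nice_on (m ^+ 2) (fun t => t `^ 2^-1) by apply: nice_on_powR; rewrite invr_gt0.
apply/funext => v; apply/eqP; rewrite -subr_eq0; apply/eqP.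
apply: (nrm_small (K := 2 * nrm v)) => e e0.
have [r hr] := weierstrass (sqr_ge0 m) nf e0.
have key s0 : positive_op s0 -> op_bound s0 m ->
    nrm (op_poly r (s0 \o s0) v - s0 v) <= e * nrm v.
  move=> ps0 s0m; rewrite -op_poly_comp_sqr; last exact: ps0.1.1.
  have /op_boundE/(_ v) : op_bound (op_poly (r \Po 'X^2 - 'X) s0) e.
    apply: spectral_bound s0m m0 _ _ _ => // t /andP[t0 tm].
    rewrite hornerD hornerN horner_comp hornerXn hornerX.
    have tm2 : 0 <= t ^+ 2 <= m ^+ 2 by rewrite sqr_ge0 /= !expr2 ler_pM.
    have := hr _ tm2.
    by rewrite powR12_sqrt ?sqr_ge0 // sqrtr_sqr (ger0_norm t0).
  by rewrite op_polyB op_polyX !fctE.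
have h1 := key s ps sm; have h2 := key s' ps' sm'; rewrite ss in h1.
set w := op_poly _ _ _ in h1 h2.
have -> : s v - s' v = - (w - s v) + (w - s' v) by rewrite opprB addrA subrK.
apply: le_trans (nrmD _ _) _; rewrite nrmN.
have -> : e * (2 * nrm v) = e * nrm v + e * nrm v by ring.
by rewrite lerD.
Qed.

Lemma positive_adjoint_comp x : bounded_op x -> positive_op (adjoint x \o x).
Proof.
move=> bx; have [ba xa] := adjointP bx; split; first exact: bounded_op_comp.
by move=> v /=; rewrite innerC -xa innervv conj_realC ler0c sqr_ge0.
Qed.

Lemma modulusP x : bounded_op x ->
  positive_op (modulus x) /\ modulus x \o modulus x = adjoint x \o x.
Proof.
move=> bx; have [s ps ss] := sqrt_op_exists (positive_adjoint_comp bx).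
by rewrite /modulus; case: xgetP => [z _ //|/(_ s)]; case.
Qed.

Lemma modulus_uniq x (s : H -> H) : positive_op s -> s \o s = adjoint x \o x -> modulus x = s.
Proof.
move=> ps ss; rewrite /modulus; case: xgetP => [z _ [pz zz]|/(_ s)]; last by case.
by apply: sqrt_op_uniq => //; rewrite zz ss.
Qed.

End FunctionalCalculus.

(** * Orthonormal families and the trace *)

Section OrthonormalFamilies.
Context {R : realType} {H : hilbertType R}.
Implicit Types (u v w : H) (e : R) (s : seq H) (b : H -> H).

Definition onseq s := uniq s /\ {in s &, forall u v, inner u v = (u == v)%:R :> R[i]}.

Definition proj s v := \sum_(w <- s) inner v w *: w.

Lemma proj_linear s : linear (proj s).
Proof.
move=> c u v; rewrite /proj scaler_sumr -big_split; apply: eq_bigr => w _ /=.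
by rewrite innerDl innerZl scalerDl scalerA.
Qed.

Lemma proj_selfadjoint s u v : inner (proj s u) v = inner u (proj s v).
Proof.
rewrite /proj inner_suml inner_sumr; apply: eq_bigr => w _.
by rewrite innerZl innerZr -innerC mulrC.
Qed.

Lemma proj_mem s u : onseq s -> u \in s -> proj s u = u.
Proof.
move=> [us os] su; rewrite /proj (bigD1_seq u) //= os // eqxx scale1r.
rewrite big_seq_cond big1 ?addr0 // => w /andP[ws wu].
by rewrite os // eq_sym (negPf wu) scale0r.
Qed.

Lemma inner_proj s u v : onseq s -> u \in s -> inner (proj s v) u = inner v u.
Proof. by move=> os su; rewrite proj_selfadjoint proj_mem. Qed.

Lemma proj_sub s t v : onseq s -> {subset t <= s} -> proj s (proj t v) = proj t v.
Proof.
move=> os ts; rewrite {2 3}/proj (lin_sum (proj_linear s)).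
rewrite [LHS]big_seq [RHS]big_seq; apply: eq_bigr => w wt.
by rewrite (linZ (proj_linear s)) proj_mem // ts.
Qed.

Lemma proj_idem s v : onseq s -> proj s (proj s v) = proj s v.
Proof. by move=> os; apply: proj_sub. Qed.

Lemma sqr_nrm_proj s v : onseq s ->
  nrm (proj s v) ^+ 2 = \sum_(u <- s) cn (inner v u) ^+ 2.
Proof.
move=> os; rewrite -ripvv /rip -proj_selfadjoint proj_idem // /proj inner_suml Re_sum.
apply: eq_bigr => u _; rewrite innerZl [inner u v]innerC mul_conj_cn //.
Qed.

Lemma pythagoras s v : onseq s ->
  nrm v ^+ 2 = nrm (proj s v) ^+ 2 + nrm (v - proj s v) ^+ 2.
Proof.
move=> os; rewrite sqr_nrmB; have -> : rip v (proj s v) = nrm (proj s v) ^+ 2.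
  by rewrite -ripvv /rip -[in RHS]proj_selfadjoint proj_idem // proj_selfadjoint.
by ring.
Qed.

Lemma nrm_proj_le s v : onseq s -> nrm (proj s v) <= nrm v.
Proof.
move=> os; apply: ler_sqr_nrm; first exact: nrm_ge0.
by rewrite (pythagoras v os) lerDl sqr_ge0.
Qed.

Lemma nrm_coproj_le s v : onseq s -> nrm (v - proj s v) <= nrm v.
Proof.
move=> os; apply: ler_sqr_nrm; first exact: nrm_ge0.
by rewrite [leRHS](pythagoras v os) lerDr sqr_ge0.
Qed.

Lemma proj_bounded s : onseq s -> bounded_op (proj s).
Proof.
move=> os; split; first exact: proj_linear.
by exists 1; apply/op_boundE => v; rewrite mul1r nrm_proj_le.
Qed.

Lemma bessel s v : onseq s -> \sum_(u <- s) cn (inner v u) ^+ 2 <= nrm v ^+ 2.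
Proof. by move=> os; rewrite -sqr_nrm_proj // (pythagoras v os) lerDl sqr_ge0. Qed.

Lemma onseq_nrm s u : onseq s -> u \in s -> nrm u = 1.
Proof.
move=> [us os] su; have := os u u su su; rewrite eqxx innervv => /complexI /eqP.
by rewrite sqrp_eq1 ?nrm_ge0 // => /eqP.
Qed.

Lemma onseq_cons s u : onseq s -> nrm u = 1 -> (forall v, v \in s -> inner u v = 0) ->
  onseq (u :: s).
Proof.
move=> [us os] u1 h; split=> /=.
  rewrite us andbT; apply/negP => /h; rewrite innervv u1 expr1n => /eqP.
  by rewrite oner_eq0.
have u0 v : v \in s -> (v == u) = false.
  move=> vs; apply/negP => /eqP vu; move: (h v vs); rewrite vu innervv u1 expr1n => /eqP.
  by rewrite oner_eq0.
move=> x y; rewrite !inE => /orP[/eqP ->|xs] /orP[/eqP ->|ys].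
- by rewrite eqxx innervv u1 expr1n.
- by rewrite h // eq_sym u0.
- by rewrite u0 // (inner_eq0C (h x xs)).
- exact: os.
Qed.

Lemma nrm_normalise w : w != 0 -> nrm ((nrm w)^-1%:C *: w) = 1.
Proof.
move=> w0; rewrite nrmZr ger0_norm ?invr_ge0 ?nrm_ge0 // mulVf //.
by rewrite nrm_eq0.
Qed.

(** Zorn's lemma for orthonormal sets: a nonzero vector orthogonal to a maximal one could be
    normalised and added. *)
Lemma hilbert_basisP : @orthonormal_basis R H hilbert_basis.
Proof.
rewrite /hilbert_basis; case: xgetP => [//|noB]; exfalso.
pose P (B : set H) := forall u v, B u -> B v -> inner u v = (u == v)%:R :> R[i].
have [F FP tF|B [PB maxB]] := @Zorn_bigcup H P.
  move=> u v [X FX Xu] [Y FY Yv].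
  by have [XY|YX] := tF X Y FX FY; [apply: (FP Y) => //; apply: XY|apply: (FP X) => //; apply: YX].
apply: (noB B); split => // v hv; apply/eqP; apply/negPn/negP => v0.
pose z := (nrm v)^-1%:C *: v; have z1 : nrm z = 1 by apply: nrm_normalise.
have zB u : B u -> inner z u = 0 by move=> Bu; rewrite innerZl hv ?mulr0.
have zz : inner z z = 1 by rewrite innervv z1 expr1n.
have nB : ~ B z by move=> /zB; rewrite zz => /eqP; rewrite oner_eq0.
apply: (maxB (z |` B)).
  by split=> [u Bu|/(_ z) h]; [right|apply/nB/h; left].
move=> x y [->|Bx] [->|By].
- by rewrite eqxx.
- by rewrite zB //; case: eqP => // zy; case: nB; rewrite zy.
- by rewrite (inner_eq0C (zB _ Bx)); case: eqP => // xz; case: nB; rewrite -xz.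
- exact: PB.
Qed.

Definition basis_seq s := uniq s /\ forall u, u \in s -> @hilbert_basis R H u.

Lemma basis_seq_onseq s : basis_seq s -> onseq s.
Proof.
move=> [us bs]; split=> // u v su sv.
by have [h _] := hilbert_basisP; apply: h; apply: bs.
Qed.

Lemma basis_seq_undup s t : basis_seq s -> basis_seq t -> basis_seq (undup (s ++ t)).
Proof.
move=> [_ bs] [_ bt]; split; first exact: undup_uniq.
by move=> u; rewrite mem_undup mem_cat => /orP[/bs|/bt].
Qed.

Lemma sum_subset_le (s t : seq H) (f : H -> R) : uniq s -> uniq t -> {subset s <= t} ->
  (forall u, u \in t -> 0 <= f u) -> \sum_(u <- s) f u <= \sum_(u <- t) f u.
Proof.
move=> us ut st f0; have -> : \sum_(u <- s) f u = \sum_(u <- t | u \in s) f u.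
  have st' : perm_eq s [seq u <- t | u \in s].
    apply: uniq_perm => //; first exact: filter_uniq.
    by move=> u; rewrite mem_filter; case: (boolP (u \in s)) => // /st ->.
  by rewrite (perm_big _ st') /= big_filter.
rewrite [leRHS](bigID (mem s)) /= lerDl big_seq_cond sumr_ge0 // => u /andP[ut' _].
exact: f0.
Qed.

(** [riesz_approx] on the span [K] of the basis represents <w, v> for w in [K] by some v' in the
    closure of [K]; v - v' is orthogonal to the basis, so v = v'. A point of [K] near v then
    provides [s]. *)
Lemma parseval v e : 0 < e -> exists2 s, basis_seq s &
  nrm v ^+ 2 <= \sum_(u <- s) cn (inner v u) ^+ 2 + e.
Proof.
move=> e0; pose K := [set w : H | exists2 s, basis_seq s & proj s w = w].
have Ku u : hilbert_basis u -> K u.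
  move=> Bu; have bu : basis_seq [:: u] by split=> // z; rewrite inE => /eqP ->.
  by exists [:: u] => //; rewrite proj_mem ?mem_head //; apply: basis_seq_onseq.
have K0 : K 0 by exists [::] => //; rewrite (lin0 (proj_linear _)).
have [|||v' [vK hv]] := @riesz_approx R H K (fun w => inner w v) (nrm v) K0.
- move=> c x y [s bs sx] [t bt ty]; exists (undup (s ++ t)); first exact: basis_seq_undup.
  have os := basis_seq_onseq (basis_seq_undup bs bt).
  rewrite proj_linear -sx -ty !proj_sub // => z zs; rewrite mem_undup mem_cat zs ?orbT //.
- by move=> c x y _ _; rewrite innerDl innerZl.
- by move=> x _; apply: le_trans (cauchy_schwarz _ _) _; rewrite mulrC.
have vv : v = v'.
  apply/eqP; rewrite -subr_eq0; apply/eqP; apply: hilbert_basisP.2 => u Bu.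
  by apply: inner_eq0C; rewrite innerDr innerNr hv ?subrr //; apply: Ku.
have se0 : 0 < Num.sqrt e by rewrite sqrtr_gt0.
have [w [s bs sw] vw] := vK _ se0.
exists s => //; have os := basis_seq_onseq bs.
rewrite (pythagoras v os) sqr_nrm_proj // lerD2l.
rewrite -(sqr_sqrtr (ltW e0)) ler_pXn2r ?nnegrE ?nrm_ge0 ?sqrtr_ge0 //.
rewrite -vv in vw; apply: le_trans vw.
have -> : v - proj s v = (v - w) - proj s (v - w).
  by rewrite (linB (proj_linear _)) sw opprB addrA subrK.
exact: nrm_coproj_le.
Qed.

Lemma parseval_seq (zs : seq H) e : 0 < e -> exists2 s, basis_seq s &
  forall z, z \in zs -> nrm z ^+ 2 <= \sum_(u <- s) cn (inner z u) ^+ 2 + e.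
Proof.
move=> e0; elim: zs => [|z zs [s bs hs]]; first by exists [::].
have [t bt ht] := parseval z e0; exists (undup (s ++ t)).
  exact: basis_seq_undup.
have sub x (r : seq H) : basis_seq r -> {subset r <= undup (s ++ t)} ->
    \sum_(u <- r) cn (inner x u) ^+ 2 + e <= \sum_(u <- undup (s ++ t)) cn (inner x u) ^+ 2 + e.
  move=> br sr; rewrite lerD2r; apply: sum_subset_le => //; first exact: br.1.
    exact: undup_uniq.
  by move=> u _; rewrite sqr_ge0.
move=> x; rewrite inE => /orP[/eqP ->|xz].
  by apply: le_trans ht (sub _ _ bt _) => u ut; rewrite mem_undup mem_cat ut orbT.
by apply: le_trans (hs x xz) (sub _ _ bs _) => u ut; rewrite mem_undup mem_cat ut.
Qed.

Section Trace.
Variable b : H -> H.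
Hypothesis b0 : forall v, 0 <= rip (b v) v.

Lemma trace_sum_le s : basis_seq s -> ((\sum_(u <- s) rip (b u) u)%:E <= trace b)%E.
Proof.
move=> [us bs]; apply: esum_ge; exists [set` s].
  by split; [exact: finite_seq|move=> u; apply: bs].
by rewrite -fsbig_seq // sumEFin.
Qed.

Lemma trace_le (T : R) : (forall s, basis_seq s -> \sum_(u <- s) rip (b u) u <= T) ->
  (trace b <= T%:E)%E.
Proof.
move=> hT; apply: ge_ereal_sup => _ [A [fA AB] <-].
rewrite fsbig_finite // sumEFin lee_fin; apply: hT; split; first exact: finmap.fset_uniq.
by move=> u; rewrite in_fset_set // inE => /AB.
Qed.

Lemma trace_ge0 : (0 <= trace b)%E.
Proof. by apply: esum_ge0 => u _; rewrite lee_fin; apply: b0. Qed.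

Lemma trace_adherent e : (trace b < +oo)%E -> 0 < e ->
  exists2 s, basis_seq s & (trace b <= (\sum_(u <- s) rip (b u) u + e)%:E)%E.
Proof.
move=> tf e0; have tn : trace b \is a fin_num by rewrite ge0_fin_numE // trace_ge0.
have [_ [A [fA AB] <-]] := ub_ereal_sup_adherent e0 tn.
rewrite fsbig_finite // sumEFin => h.
exists (finmap.enum_fset (fset_set A)).
  split; first exact: finmap.fset_uniq.
  by move=> u; rewrite in_fset_set // inE => /AB.
by rewrite EFinD -leeBlDr // ltW.
Qed.

End Trace.

(** With r the square root of b, <b v, v> = |r v|^2. Expand each r v in the basis, exchange the sums
    and apply Bessel to r u for every basis vector u: what remains is a sum of |r u|^2 = <b u, u>,
    at most the trace. *)
Lemma trace_onseq b (T : R) s : positive_op b -> (trace b <= T%:E)%E -> onseq s ->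
  \sum_(v <- s) rip (b v) v <= T.
Proof.
move=> pb bT os; have [r pr rr] := sqrt_op_exists pb.
have bE v : rip (b v) v = nrm (r v) ^+ 2.
  by rewrite -rr /rip /= (positive_selfadjoint pr) -/(rip _ _) ripvv.
apply/ler_addgt0Pl => e e0.
have n0 : 0 < (size s).+1%:R :> R by rewrite ltr0Sn.
have [t bt ht] := parseval_seq (map r s) (divr_gt0 e0 n0).
apply: le_trans (_ : \sum_(v <- s) (\sum_(u <- t) cn (inner (r v) u) ^+ 2 + e / (size s).+1%:R) <= _).
  rewrite big_seq [leRHS]big_seq; apply: ler_sum => v vs.
  by rewrite bE; apply: ht; apply: map_f.
rewrite big_split /= addrC lerD //.
  rewrite big_const_seq count_predT iter_addr_0 -[_ *+ size s]mulr_natl mulrCA ler_piMr ?(ltW e0) //.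
  by rewrite ler_pdivrMr // mul1r ler_nat.
rewrite exchange_big /=; apply: le_trans (_ : \sum_(u <- t) rip (b u) u <= _).
  apply: ler_sum => u _; rewrite bE; apply: le_trans (bessel (r u) os).
  rewrite le_eqVlt; apply/orP; left; apply/eqP; apply: eq_bigr => v _.
  by rewrite (positive_selfadjoint pr) [inner v _]innerC cn_conj.
rewrite -lee_fin; apply: le_trans bT; apply: trace_sum_le bt.
Qed.

End OrthonormalFamilies.

(** * Finite-rank approximation in the Schatten classes *)

Section Eigenvectors.
Context {R : realType} {H : hilbertType R}.
Variables (a : H -> H) (S : set H).
Hypothesis la : linear a.
Hypothesis SL : forall (c : R[i]) u v, S u -> S v -> S (c *: u + v).
Hypothesis Sa : forall u, S u -> S (a u).

Lemma invariant_foldr (s : seq R[i]) (w : H) : S w ->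
  S (foldr (fun z w => a w - z *: w) w s).
Proof.
move=> Sw; elim: s => //= z s IH; rewrite -scaleNr addrC; apply: SL => //.
exact: Sa.
Qed.

(** Apply the factors a - z of [q] to [w] one after the other: the last nonzero vector is an
    eigenvector. *)
Lemma annihilated_eigenvector (q : {poly R[i]}) (w : H) : q != 0 -> S w -> w != 0 ->
  pev q a w = 0 -> exists z w', [/\ S w', w' != 0 & a w' = z *: w'].
Proof.
move=> q0 Sw w0; have [s ->] := closed_field_poly_normal q.
rewrite pevZ pev_prod_root // => /eqP; rewrite scaler_eq0 lead_coef_eq0 (negPf q0) /=.
elim: s => [|z s IH] /=; first by rewrite (negPf w0).
have [h0|n0] := eqVneq (foldr (fun z w => a w - z *: w) w s) 0.
  by move=> _; apply: IH; rewrite h0.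
rewrite subr_eq0 => /eqP h; exists z, (foldr (fun z w => a w - z *: w) w s).
by split=> //; apply: invariant_foldr.
Qed.

(* Orthonormalising w, a w, a^2 w, ... must stop, that is, some polynomial in a
   kills w. *)
Lemma krylov_eigenvector (N : nat) (w : H) :
  (forall t, onseq t -> (forall u, u \in t -> S u) -> (size t <= N)%N) ->
  S w -> w != 0 -> exists z w', [/\ S w', w' != 0 & a w' = z *: w'].
Proof.
move=> hN Sw w0.
pose K k := [set v : H | exists2 q : {poly R[i]}, (size q <= k)%N & v = pev q a w].
have KD k u v : K k u -> K k v -> K k (u + v).
  move=> [q qk ->] [q' q'k ->]; exists (q + q'); last by rewrite pevD.
  by rewrite (leq_trans (size_polyD _ _)) // geq_max qk.
have KZ k c v : K k v -> K k (c *: v).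
  move=> [q qk ->]; exists (c *: q); last by rewrite pevZ.
  by rewrite (leq_trans (size_scale_leq _ _)).
have K0 k : K k 0 by exists 0; rewrite ?size_poly0 // pev0.
have KS k v : K k v -> S v.
  move=> [q _ ->]; elim/poly_ind: q => [|q c IH].
    by rewrite pev0 -(addNr w) -scaleN1r; apply: SL.
  rewrite pevD pev_mulX pevC pev_comm // addrC; apply: SL => //; exact: Sa.
suff [[q q0 qw]|[t [ot tN tK]]] : (exists2 q : {poly R[i]}, q != 0 & pev q a w = 0) \/
    (exists t, [/\ onseq t, size t = N.+1 & forall u, u \in t -> K N.+1 u]).
- exact: annihilated_eigenvector q0 Sw w0 qw.
- by have := hN t ot (fun u ut => KS _ _ (tK u ut)); rewrite tN ltnn.
elim: N.+1 => [|k [h|[t [ot tk tK]]]]; [by right; exists [::]|by left|].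
have [q qk qE] : K k (proj t (iter k a w)).
  rewrite /proj big_seq; elim/big_ind: _ => [|u v|u ut]; [exact: K0|exact: KD|].
  by apply/KZ/tK.
(* [q] has degree less than [k], so [Q] is nonzero: either [Q(a) w] vanishes or, normalised, it
   extends the family. *)
pose Q := 'X^k - q.
have sQ : size Q = k.+1 by rewrite size_polyDl ?size_polyXn // size_polyN.
have EQ : pev Q a w = iter k a w - proj t (iter k a w).
  by rewrite qE pevD pevXn -scaleN1r pevZ scaleN1r.
have [z0|z0] := eqVneq (pev Q a w) 0.
  by left; exists Q => //; rewrite -size_poly_gt0 sQ.
right; exists ((nrm (pev Q a w))^-1%:C *: pev Q a w :: t); split.
- apply: onseq_cons => //; first exact: nrm_normalise.
  by move=> v vt; rewrite innerZl EQ innerDl innerNl inner_proj // subrr mulr0.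
- by rewrite /= tk.
- move=> u; rewrite inE => /orP[/eqP ->|/tK[q' q'k ->]].
    by apply: KZ; exists Q => //; rewrite sQ.
  by exists q' => //; apply: leqW.
Qed.

End Eigenvectors.

(** * Schatten norms and finite-rank operators *)

Section Schatten.
Context {R : realType} {H : hilbertType R}.
Implicit Types (u v w : H) (e p M : R) (s : seq H) (x y a b : H -> H).

Lemma schatten_normE p x : 0 < p -> bounded_op x -> exists M b,
  [/\ 0 <= M, op_bound (modulus x) M, positive_op b,
      is_cfc M (fun t => t `^ p) (modulus x) b
    & schatten_norm p x = (trace b `^ p^-1)%E].
Proof.
move=> p0 bx; have [pa _] := modulusP bx.
have [M M0 /op_boundE aM] := bounded_opP pa.1.
have [b bb hb] := is_cfc_exists pa aM M0 (nice_on_powR M p0).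
exists M, b; split => //.
  by apply: (is_cfc_positive pa aM M0 bb hb) => t _; apply: powR_ge0.
by rewrite /schatten_norm (cfcE pa aM M0 bb hb).
Qed.

Lemma nrm_positive_ker a v : positive_op a -> a (a v) = 0 -> a v = 0.
Proof.
move=> pa h; apply/eqP; rewrite -nrm_eq0 -sqrf_eq0 -ripvv /rip.
by rewrite -(positive_selfadjoint pa) h inner0l.
Qed.

(** With e = proj s, b vanishes on the range of 1 - e, so <b u, u> = <b e u, e u> <= C |e u|^2; by
    Bessel the sum of |e u|^2 over basis vectors is at most the length of [s]. *)
Lemma schatten_finite_rank p x s : 0 < p -> bounded_op x -> onseq s ->
  (forall v, x (proj s v) = x v) -> schatten p x.
Proof.
move=> p0 bx os xs; split => //.
have [M [b [M0 aM pb hb ->]]] := schatten_normE p0 bx.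
have [pa aa] := modulusP bx.
have bs v : b (v - proj s v) = 0.
  apply: (is_cfc_ker pa M0 hb); first by rewrite powR0 // gt_eqF.
  apply: nrm_positive_ker => //.
  have -> : modulus x (modulus x (v - proj s v)) = adjoint x (x (v - proj s v)).
    by have := congr1 (fun f => f (v - proj s v)) aa.
  by rewrite (linB bx.1) xs subrr (lin0 (adjointP bx).1.1).
have bE v : rip (b v) v = rip (b (proj s v)) (proj s v).
  have {1}-> : b v = b (proj s v).
    by apply/eqP; rewrite -subr_eq0 -(linB pb.1.1) bs.
  rewrite /rip !(positive_selfadjoint pb); congr (complex.Re (inner _ _)).
  by apply/eqP; rewrite -subr_eq0 -(linB pb.1.1) bs.
have [C C0 hC] := bounded_opP pb.1.
apply: poweR_lty; apply: le_lt_trans (_ : _ <= (C * (size s)%:R)%:E)%E _; last by rewrite ltry.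
apply: trace_le => t bt; apply: le_trans (_ : \sum_(u <- t) C * nrm (proj s u) ^+ 2 <= _).
  apply: ler_sum => u _; rewrite bE; apply: le_trans (rip_le _ _) _.
  by rewrite expr2 mulrA ler_wpM2r ?nrm_ge0.
rewrite -mulr_sumr ler_wpM2l //.
under eq_bigr do rewrite sqr_nrm_proj //.
rewrite exchange_big /= -sum1_size natr_sum big_seq [leRHS]big_seq.
apply: ler_sum => w ws.
apply: le_trans (_ : nrm w ^+ 2 <= _); last by rewrite (onseq_nrm os ws) expr1n.
apply: le_trans (bessel w (basis_seq_onseq bt)).
rewrite le_eqVlt; apply/orP; left; apply/eqP; apply: eq_bigr => v _.
by rewrite innerC cn_conj.
Qed.

Lemma proj_comm a s : positive_op a ->
  (forall v, v \in s -> exists r : R, a v = r%:C *: v) ->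
  forall v, proj s (a v) = a (proj s v).
Proof.
move=> pa hs v; rewrite /proj (lin_sum pa.1.1) big_seq [RHS]big_seq.
apply: eq_bigr => w ws; have [r aw] := hs w ws.
rewrite (linZ pa.1.1) aw (positive_selfadjoint pa) aw innerZr conj_realC scalerA.
by rewrite mulrC.
Qed.

(** * Compression to the complement of a finite orthonormal family *)

Section Compression.
Variables (a b : H -> H) (M p : R) (s : seq H).
Hypothesis pa : positive_op a.
Hypothesis aM : op_bound a M.
Hypothesis M0 : 0 <= M.
Hypothesis p0 : 0 < p.
Hypothesis hb : is_cfc M (fun t => t `^ p) a b.
Hypothesis pb : positive_op b.
Hypothesis os : onseq s.
Hypothesis as_ : forall v, proj s (a v) = a (proj s v).

Let d v := v - proj s v.
Let la : linear a := pa.1.1.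

Lemma coproj_linear : linear d.
Proof.
by move=> c u v; rewrite /d proj_linear scalerBr opprD addrACA.
Qed.

Lemma coproj_idem v : d (d v) = d v.
Proof.
by rewrite {1}/d {2}/d (linB (proj_linear s)) proj_idem // subrr subr0.
Qed.

Lemma coproj_selfadjoint u v : inner (d u) v = inner u (d v).
Proof. by rewrite /d !(innerDl, innerDr, innerNl, innerNr) proj_selfadjoint. Qed.

Lemma coproj_bounded : bounded_op d.
Proof.
split; first exact: coproj_linear.
by exists 1; apply/op_boundE => v; rewrite mul1r nrm_coproj_le.
Qed.

Lemma coproj_comm v : d (a v) = a (d v).
Proof. by rewrite /d as_ (linB la). Qed.

Lemma compression_positive : positive_op (a \o d).
Proof.
split; first exact: bounded_op_comp pa.1 coproj_bounded.
move=> v /=; rewrite -coproj_idem -coproj_comm coproj_selfadjoint.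
exact: pa.2.
Qed.

Lemma compression_sqr : (a \o d) \o (a \o d) = a \o a \o d.
Proof. by apply/funext => v /=; rewrite coproj_comm coproj_idem. Qed.

Lemma compression_bound : op_bound (a \o d) M.
Proof.
apply/op_boundE => v /=; have /op_boundE h := aM.
by apply: le_trans (h _) _; rewrite ler_wpM2l // nrm_coproj_le.
Qed.

(** The constant term of q acts on all of [v] on the left but only on [d v] inside q(a), hence the
    correction. It is small for the approximations of t^p, where q(0) is close to 0. *)
Lemma op_poly_compression (q : {poly R}) v :
  op_poly q (a \o d) v = op_poly q a (d v) + (q.[0])%:C *: proj s v.
Proof.
have lc := compression_positive.1.1.
elim/poly_ind: q v => [|q c IH] v.
  by rewrite -polyC0 !op_polyC hornerC !scale0r addr0.
rewrite !op_polyD !fctE !op_polyM // !op_polyX !op_polyC /= IH.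
rewrite coproj_comm coproj_idem !hornerE.
have -> : proj s (a (d v)) = 0.
  by rewrite -coproj_comm /d (linB (proj_linear s)) proj_idem // subrr.
by rewrite scaler0 addr0 -addrA -scalerDr subrK.
Qed.

Lemma is_cfc_compression : is_cfc M (fun t => t `^ p) (a \o d) (b \o d).
Proof.
move=> e e0; have [q [qf qb]] := hb (divr_gt0 e0 (ltr0Sn R 1)).
exists q; split=> [t ht|v].
  by apply: le_trans (qf t ht) _; rewrite ler_pdivrMr // ler_peMr ?(ltW e0) // ler1n.
rewrite op_poly_compression /= addrAC; apply: le_trans (nrmD _ _) _.
rewrite [in leRHS](splitr e) mulrDl lerD //.
  apply: le_trans (qb _) _.
  by rewrite ler_wpM2l ?nrm_coproj_le // ltW // divr_gt0.
rewrite nrmZr ler_pM ?nrm_ge0 ?nrm_proj_le //.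
by have := qf 0; rewrite lexx M0 powR0 ?gt_eqF // subr0; apply.
Qed.

(** Since d = 1 - e commutes with a, the square of |x d| is d a^2 d = (a d)^2; so a d is the
    modulus, and b d its p-th power. *)
Lemma schatten_norm_compression x : bounded_op x -> modulus x = a ->
  schatten_norm p (x \o proj s - x) = (trace (b \o d) `^ p^-1)%E.
Proof.
move=> bx xa; have [ba adj] := adjointP bx.
have yE : x \o proj s - x = - (x \o d).
  by apply/funext => v; rewrite !fctE /d (linB bx.1) opprB.
have -> : modulus (x \o proj s - x) = a \o d -> schatten_norm p (x \o proj s - x) =
    (trace (b \o d) `^ p^-1)%E.
  move=> h; rewrite /schatten_norm h.
  by rewrite (cfcE compression_positive compression_bound M0 (bounded_op_comp pb.1 coproj_bounded)
    is_cfc_compression).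
- by [].
have [_ aa] := modulusP bx; rewrite xa in aa.
rewrite yE; apply: modulus_uniq; first exact: compression_positive.
have -> : adjoint (- (x \o d)) = - (d \o adjoint x).
  apply: adjoint_uniq; first by apply/bounded_opN/bounded_op_comp; [exact: coproj_bounded|].
  by move=> u v; rewrite !fctE innerNl innerNr adj coproj_selfadjoint.
rewrite compression_sqr; apply/funext => v; rewrite !fctE /=.
rewrite (linN ba.1) (linN coproj_linear) opprK.
have -> : adjoint x (x (d v)) = a (a (d v)) by have := congr1 (fun f => f (d v)) aa.
by rewrite !coproj_comm coproj_idem.
Qed.

(** A dominated convergence argument: [t0] carries Tr(b) up to eta. Basis vectors in [t0] contribute
    at most mu each, hence at most eta together; those outside contribute no more than they do to
    Tr(b), again at most eta. *)
Lemma trace_compression_le (eta mu : R) t0 : basis_seq t0 -> 0 < eta ->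
  (trace b <= (\sum_(u <- t0) rip (b u) u + eta)%:E)%E ->
  0 <= mu -> (size t0)%:R * mu <= eta ->
  (forall v, rip (b (d v)) (d v) <= mu * nrm (d v) ^+ 2) ->
  (trace (b \o d) <= (eta *+ 2)%:E)%E.
Proof.
move=> bt0 eta0 tb mu0 tmu hmu.
have bs : forall v, proj s (b v) = b (proj s v).
  by apply: (is_cfc_comm pa hb (proj_bounded os)).
have bd v : d (b v) = b (d v) by rewrite /d bs (linB pb.1.1).
have dE v : rip (b (d v)) v = rip (b (d v)) (d v).
  by rewrite -{1}(coproj_idem v) -bd /rip coproj_selfadjoint.
have h1 u : rip (b (d u)) u <= rip (b u) u.
  have -> : b u = b (d u) + b (proj s u) by rewrite -(linD pb.1.1) subrK.
  rewrite ripDl lerDl -(proj_idem u os) -bs /rip proj_selfadjoint.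
  exact: positive_rip.
apply: trace_le => t bt; rewrite (bigID (mem t0)) /= mulr2n lerD //.
  rewrite -big_filter; apply: le_trans tmu.
  apply: le_trans (_ : \sum_(u <- [seq i <- t | i \in t0]) mu <= _).
    rewrite big_seq [leRHS]big_seq; apply: ler_sum => u.
    rewrite mem_filter => /andP[_ ut]; rewrite dE; apply: le_trans (hmu _) _.
    rewrite ler_piMr // exprn_ile1 ?nrm_ge0 //.
    by rewrite -(onseq_nrm (basis_seq_onseq bt) ut) nrm_coproj_le.
  apply: le_trans (_ : \sum_(u <- t0) mu <= _).
    apply: sum_subset_le => //; [exact/filter_uniq/bt.1|exact: bt0.1|].
    by move=> u; rewrite mem_filter => /andP[].
  by rewrite big_const_seq count_predT iter_addr_0 mulr_natl.
apply: le_trans (_ : \sum_(u <- t | u \notin t0) rip (b u) u <= _).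
  by apply: ler_sum => u _; apply: h1.
have b2 : basis_seq (t0 ++ [seq u <- t | u \notin t0]).
  split.
    rewrite cat_uniq bt0.1 filter_uniq ?bt.1 // andbT /=.
    by apply/hasPn => u; rewrite mem_filter => /andP[].
  move=> u; rewrite mem_cat mem_filter => /orP[|/andP[_]]; [exact: bt0.2|exact: bt.2].
have := le_trans (trace_sum_le b b2) tb.
by rewrite lee_fin big_cat /= lerD2l big_filter.
Qed.

End Compression.

Lemma schatten_approx p x e : 0 < p -> schatten p x -> 0 < e ->
  exists2 s, onseq s /\ (forall v, v \in s -> exists r : R, modulus x v = r%:C *: v) &
    (schatten_norm p (x \o proj s - x)%R < e%:E)%E.
Proof.
move=> p0 [bx xp] e0.
have [M [b [M0 aM pb hb xE]]] := schatten_normE p0 bx.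
have [pa aa] := modulusP bx; set a := modulus x in aM hb pa aa *.
have tf : (trace b < +oo)%E.
  by move: xp; rewrite xE; apply: lty_poweRy; rewrite invr_eq0 gt_eqF.
have b0 v : 0 <= rip (b v) v by apply: positive_rip.
have tn : trace b \is a fin_num by rewrite ge0_fin_numE // trace_ge0.
pose T := fine (trace b); have TE : trace b = T%:E by rewrite fineK.
(* The trace of the compression will be at most 2 eta = e^p / 2, strictly below e^p as the strict
   norm bound requires. *)
pose eta := e `^ p / 4; have eta0 : 0 < eta by rewrite divr_gt0 ?powR_gt0.
have [t0 bt0 tb] := trace_adherent b0 tf eta0.
have n0 : 0 < (size t0).+1%:R :> R by rewrite ltr0Sn.
(* Makes [mu] times the length of [t0] at most [eta]; the successor covers an empty [t0]. *)
pose mu := eta / (size t0).+1%:R; have mu0 : 0 < mu by rewrite divr_gt0.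
have tmu : (size t0)%:R * mu <= eta.
  by rewrite /mu mulrCA ler_piMr ?(ltW eta0) // ler_pdivrMr // mul1r ler_nat.
have nf := nice_on_powR M p0; have ng := nice_on_max_sub mu nf.
have [c bc hc] := is_cfc_exists pa aM M0 ng.
set g := fun t => _ in ng hc.
have g0 t : 0 <= g t by rewrite /g le_max lexx orbT.
have pc : positive_op c by apply: (is_cfc_positive pa aM M0 bc hc) => t _.
(* (f - mu) g^2 >= 0, for f = t^p and g = max(f - mu, 0) *)
have cmu z : mu * nrm (c z) ^+ 2 <= rip (b (c z)) (c z).
  have h1 := is_cfc_lin 1 hb (is_cfc_cst a M (- mu)).
  have bh1 : bounded_op (1%:C *: b + (- mu)%:C *: id).
    by apply: bounded_opD; apply: bounded_opZ; [exact: pb.1|exact: bounded_op_id].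
  have nh : bounded_fun_on M (fun t => 1 * t `^ p + - mu).
    have [K K0 hK] := nf.2; exists (K + mu) => [|t ht]; first by rewrite addr_ge0 // ltW.
    rewrite mul1r; apply: le_trans (ler_normD _ _) _.
    by rewrite normrN (gtr0_norm mu0) lerD2r hK.
  have h2 := is_cfc_mul pa aM M0 nh ng.2 bh1 bc h1 hc.
  have nh2 : bounded_fun_on M (fun t => (1 * t `^ p + - mu) * g t).
    have [K K0 hK] := nh; have [L L0 hL] := ng.2; exists (K * L); first exact: mulr_ge0.
    by move=> t ht; rewrite normrM ler_pM ?hK ?hL.
  have h3 := is_cfc_mul pa aM M0 ng.2 nh2 bc (bounded_op_comp bh1 bc) hc h2.
  have p3 : positive_op (c \o ((1%:C *: b + (- mu)%:C *: id) \o c)).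
    apply: (is_cfc_positive pa aM M0 (bounded_op_comp bc (bounded_op_comp bh1 bc)) h3).
    move=> t _; rewrite /g mul1r; case: (leP (t `^ p - mu) 0) => h.
      by rewrite mul0r.
    by rewrite !mulr_ge0 // ltW.
  have := positive_rip z p3.
  rewrite /rip /= (positive_selfadjoint pc) -/(rip _ _) !fctE ripDl !ripZl ripvv.
  by rewrite mul1r mulNr subr_ge0.
pose P s := onseq s /\ forall v, v \in s ->
  (exists r : R, a v = r%:C *: v) /\ mu <= rip (b v) v.
pose N := Num.truncn (T / mu).
have sizeN s : onseq s -> (forall v, v \in s -> mu <= rip (b v) v) -> (size s <= N)%N.
  move=> os hs; rewrite /N truncn_ge_nat; last first.
    by rewrite divr_ge0 ?(ltW mu0) //; apply: fine_ge0; apply: trace_ge0.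
  rewrite ler_pdivlMr //; apply: le_trans (trace_onseq pb _ os); last by rewrite TE.
  rewrite mulr_natl -iter_addr_0 -count_predT -big_const_seq big_seq [leRHS]big_seq.
  exact: ler_sum.
(* [N] bounds the lengths, so a family of greatest length exists; this excludes the longer family
   [w :: s] below. *)
have [s [os Ps] smax] : exists2 s, P s & forall s', P s' -> (size s' <= size s)%N.
  pose Q n := `[< exists2 s, P s & size s = n >].
  have exQ : exists n, Q n by exists 0%N; apply/asboolP; exists [::].
  have ubQ n : Q n -> (n <= N)%N.
    by move=> /asboolP[s [os Ps] <-]; apply: sizeN => // v /Ps[].
  have [n /asboolP[s Ps <-] h] := ex_maxnP exQ ubQ.
  by exists s => // s' Ps'; apply: h; apply/asboolP; exists s'.
have sa v : v \in s -> exists r : R, a v = r%:C *: v by move=> /Ps[].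
have as_ := proj_comm pa sa.
have cs : forall v, proj s (c v) = c (proj s v).
  by apply: (is_cfc_comm pa hc (proj_bounded os)).
have ca : forall v, a (c v) = c (a v) by apply: (is_cfc_comm pa hc pa.1).
have cd v : c (v - proj s v) = 0.
  apply/eqP/negPn/negP => w0.
  (* The range of c (1 - e) is invariant under [a], and [cmu] gives <b u, u> >= mu for its unit
     vectors, so [sizeN] bounds its orthonormal families, as [krylov_eigenvector] requires. *)
  pose S := [set w : H | exists z, w = c (z - proj s z)].
  have SL (k : R[i]) u w : S u -> S w -> S (k *: u + w).
    move=> [z ->] [z' ->]; exists (k *: z + z').
    by rewrite proj_linear -bc.1 scalerBr opprD addrACA.
  have Sv : S (c (v - proj s v)) by exists v.
  have [||z [w' [[z' w'E] w'0 aw']]] := @krylov_eigenvector R H a S pa.1.1 SL _ N _ _ Sv w0.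
  - by move=> u [z ->]; exists (a z); rewrite ca as_ (linB pa.1.1).
  - move=> t ot tS; apply: sizeN => // u ut.
    have [z uE] := tS u ut; have := cmu (z - proj s z).
    by rewrite -uE (onseq_nrm ot ut) expr1n mulr1.
  pose w := (nrm w')^-1%:C *: w'; have w1 : nrm w = 1 by apply: nrm_normalise.
  have wE : w = c ((nrm w')^-1%:C *: (z' - proj s z')) by rewrite (linZ bc.1) -w'E.
  have : P (w :: s).
    split.
      apply: onseq_cons => // u us.
      by rewrite innerZl w'E (linB bc.1) -cs innerDl innerNl inner_proj // subrr mulr0.
    move=> u; rewrite inE => /orP[/eqP ->|]; last exact: Ps.
    split; last by have := cmu ((nrm w')^-1%:C *: (z' - proj s z')); rewrite -wE w1 expr1n mulr1.
    have aw : a w = z *: w by rewrite (linZ pa.1.1) aw' !scalerA mulrC.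
    (* The eigenvalue equals <a w, w>, which is real because [a] is positive. *)
    exists (rip (a w) w); rewrite -positive_innerE //.
    by rewrite aw innerZl innervv w1 expr1n mulr1.
  by move=> /smax; rewrite /= ltnn.
(* The function g + mu - t^p is nonnegative, and c = g(a) vanishes on the complement of [s]. *)
have hmu v : rip (b (v - proj s v)) (v - proj s v) <= mu * nrm (v - proj s v) ^+ 2.
  have h1 := is_cfc_lin (-1) hb (is_cfc_lin 1 hc (is_cfc_cst a M mu)).
  have bh1 : bounded_op ((-1)%:C *: b + (1%:C *: c + mu%:C *: id)).
    apply: bounded_opD; first exact/bounded_opZ/pb.1.
    by apply: bounded_opD; apply: bounded_opZ; [|exact: bounded_op_id].
  have p1 : positive_op ((-1)%:C *: b + (1%:C *: c + mu%:C *: id)).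
    apply: (is_cfc_positive pa aM M0 bh1 h1) => t _; rewrite /g.
    by case: (leP (t `^ p - mu) 0) => h; lra.
  have := positive_rip (v - proj s v) p1.
  rewrite !fctE !ripDl !ripZl cd rip0l ripvv; lra.
exists s => //; rewrite (schatten_norm_compression pa aM M0 p0 hb pb os as_ bx erefl).
have := trace_compression_le pa hb pb os as_ bt0 eta0 tb (ltW mu0) tmu hmu.
set tr := trace _ => tr2.
have tr0 : (0 <= tr)%E.
  apply: trace_ge0 => v.
  have pbd := compression_positive pb os (is_cfc_comm pa hb (proj_bounded os) as_).
  exact: positive_rip pbd.
have trn : tr \is a fin_num by rewrite ge0_fin_numE // (le_lt_trans tr2) // ltry.
have p1 : 0 < p^-1 by rewrite invr_gt0.
rewrite -(fineK trn) poweR_EFin lte_fin.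
have -> : e = (e `^ p) `^ p^-1 by rewrite -powRrM mulfV ?gt_eqF // powRr1 // ltW.
apply: gt0_ltr_powR => //; rewrite ?nnegrE ?fine_ge0 ?powR_ge0 //.
apply: le_lt_trans (_ : eta *+ 2 < _); first by rewrite -lee_fin fineK.
have := powR_gt0 p e0; rewrite /eta mulr2n; lra.
Qed.

End Schatten.

(** * Vanishing on finite-rank operators *)

Section CircleInterpolation.
Context {R : realType} {X : lmodType R[i]}.

(** The Cayley transform (1 + i k) / (1 - i k), a source of infinitely many points on the unit
    circle. *)
Definition circle_point (k : nat) : R[i] :=
  Complex 1 k%:R / Num.conj (Complex 1 (k%:R : R)).

Lemma circle_point_den k : Complex 1 (k%:R : R) != 0.
Proof. by rewrite eq_complex /= oner_eq0. Qed.

Lemma circle_point_norm k : cn (circle_point k) = 1.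
Proof.
have k0 := circle_point_den k.
rewrite /circle_point /cn normrM normfV norm_conjC mulfV //.
by rewrite normr_eq0.
Qed.

Lemma circle_point_inj : injective circle_point.
Proof.
move=> j k /eqP; rewrite /circle_point eqr_div ?conjC_eq0 ?circle_point_den //.
rewrite eq_complex /= => /andP[_ /eqP h].
by apply/eqP; rewrite -(eqr_nat R); apply/eqP; lra.
Qed.

(** The last column [w] of the inverse Vandermonde matrix of d + 1 points t_j of the circle extracts
    the coefficient: the sum over j of w_j t_j^i is 1 for i = d and 0 for i < d. *)
Lemma circle_poly_top (d : nat) (C : nat -> X) :
  (forall t : R[i], cn t = 1 -> \sum_(i < d.+1) t ^+ i *: C i = 0) -> C d = 0.
Proof.
move=> h; pose a := \row_(j < d.+1) circle_point j.
pose V := Vandermonde d.+1 a.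
have Vu : V \in unitmx.
  rewrite unitmxE det_Vandermonde unitfE; apply/prodf_neq0 => i _.
  apply/prodf_neq0 => j ij; rewrite !mxE subr_eq0 (inj_eq circle_point_inj).
  by rewrite gt_eqF.
pose w : 'cV[R[i]]_d.+1 := invmx V *m delta_mx ord_max 0.
have Vw : V *m w = delta_mx ord_max 0 by rewrite mulKVmx.
have : \sum_(j < d.+1) w j 0 *: \sum_(i < d.+1) circle_point j ^+ i *: C i = 0.
  by rewrite big1 // => j _; rewrite h ?circle_point_norm // scaler0.
under eq_bigr do rewrite scaler_sumr.
rewrite exchange_big /= => <-; rewrite (bigD1 ord_max) //= [X in _ + X]big1 ?addr0; last first.
  move=> i id; under eq_bigr do rewrite scalerA.
  rewrite -scaler_suml; have -> : \sum_(j < d.+1) w j 0 * circle_point j ^+ i = (V *m w) i 0.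
    by rewrite mxE; apply: eq_bigr => j _; rewrite !mxE mulrC.
  by rewrite Vw mxE (negPf id) scale0r.
under eq_bigr do rewrite scalerA.
rewrite -scaler_suml; have -> : \sum_(j < d.+1) w j 0 * circle_point j ^+ d = (V *m w) ord_max 0.
  by rewrite mxE; apply: eq_bigr => j _; rewrite !mxE mulrC.
by rewrite Vw mxE !eqxx scale1r.
Qed.

(** A degree bound with its possibly zero coefficient, so that terms of lower degree can be padded
    and added. *)
Definition poly_top (d : nat) (f : R[i] -> X) (c : X) := exists2 C : nat -> X,
  forall t, f t = \sum_(i < d.+1) t ^+ i *: C i & C d = c.

Lemma poly_topD d f g c c' : poly_top d f c -> poly_top d g c' ->
  poly_top d (fun t => f t + g t) (c + c').
Proof.
move=> [C fC Cc] [C' gC Cc']; exists (fun i => C i + C' i); last by rewrite Cc Cc'.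
by move=> t; rewrite fC gC -big_split; apply: eq_bigr => i _; rewrite scalerDr.
Qed.

Lemma poly_topN d f c : poly_top d f c -> poly_top d (fun t => - f t) (- c).
Proof.
move=> [C fC Cc]; exists (fun i => - C i); last by rewrite Cc.
by move=> t; rewrite fC -sumrN; apply: eq_bigr => i _; rewrite scalerN.
Qed.

Lemma poly_top_shift d f c : poly_top d f c -> poly_top d.+1 (fun t => t *: f t) c.
Proof.
move=> [C fC Cc]; exists (fun i => if i is j.+1 then C j else 0) => // t.
rewrite big_ord_recl scaler0 add0r fC scaler_sumr; apply: eq_bigr => i _ /=.
by rewrite scalerA -exprS.
Qed.

Lemma poly_top_widen d f c : poly_top d f c -> poly_top d.+1 f 0.
Proof.
move=> [C fC Cc]; exists (fun i => if (i <= d)%N then C i else 0); last by rewrite ltnn.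
move=> t; rewrite big_ord_recr /= ltnn scaler0 addr0 fC; apply: eq_bigr => i _.
by rewrite -ltnS ltn_ord.
Qed.

Lemma poly_top_circle d f c : poly_top d f c ->
  (forall t : R[i], cn t = 1 -> f t = 0) -> c = 0.
Proof.
move=> [C fC <-] f0; apply: circle_poly_top => t t1; by rewrite -fC f0.
Qed.

End CircleInterpolation.

Section QuadraticCurves.
Context {K : nzRingType} {V : lmodType K}.

(** Curves are kept in Horner form t (t a + b) + c, to which [multilinear_on] applies twice. *)
Lemma quadratic_opp (t : K) (a b c : V) :
  (- t) *: ((- t) *: a + b) + c = t *: (t *: a + - b) + c.
Proof. by rewrite scaleNr -scalerN opprD scaleNr opprK. Qed.

Lemma quadratic_addN (t : K) (a b c : V) :
  (t *: (t *: a + b) + c) + (t *: (t *: a + - b) + c) = t *: (t *: (2 *: a) + 0) + 2 *: c.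
Proof.
rewrite addr0 addrACA -scalerDr addrACA subrr addr0 -scalerDr.
by rewrite -[c + c]mulr2n -[a + a]mulr2n -!scaler_nat.
Qed.

End QuadraticCurves.

(** * Homogeneity and leading coefficients of multilinear maps *)

Section Multilinear.
Context {R : realType} {V X : lmodType R[i]}.
Variables (S : set V) (m : nat) (phi : ('I_m -> V) -> X).
Hypothesis S0 : S 0.
Hypothesis SL : forall (c : R[i]) u v, S u -> S v -> S (c *: u + v).
Hypothesis phiL : multilinear_on S phi.

Lemma multilinear0 (i : 'I_m) (w : 'I_m -> V) : (forall j, S (w j)) ->
  phi (dfwith w i 0) = 0.
Proof.
move=> Sw; have := phiL i 1 Sw S0 S0; rewrite scaler0 addr0 scale1r => /eqP.
by rewrite -subr_eq subrr eq_sym => /eqP.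
Qed.

Lemma multilinearZ (i : 'I_m) (w : 'I_m -> V) c u : (forall j, S (w j)) -> S u ->
  phi (dfwith w i (c *: u)) = c *: phi (dfwith w i u).
Proof.
by move=> Sw Su; have := phiL i c Sw Su S0; rewrite addr0 multilinear0 // addr0.
Qed.

(** Interpolates between a given tuple and a constant one: raising [k] by one changes a single slot,
    where linearity applies. *)
Let prefix (k : nat) (x : V) (w : 'I_m -> V) : 'I_m -> V :=
  fun j => if (j < k)%N then x else w j.

Lemma prefixS (k : nat) (km : (k < m)%N) x w :
  prefix k.+1 x w = dfwith (prefix k x w) (Ordinal km) x.
Proof.
apply/funext => j; rewrite /prefix; case: dfwithP => [|j' jk]; first by rewrite /= ltnSn.
rewrite ltnS leq_eqVlt; case: eqP => //= h; case/eqP: jk; exact/val_inj.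
Qed.

Lemma dfwith_prefix (k : nat) (km : (k < m)%N) x y (w : 'I_m -> V) :
  dfwith (prefix k x w) (Ordinal km) y = prefix k x (dfwith w (Ordinal km) y).
Proof.
apply/funext => j; rewrite /prefix; case: dfwithP => [|j' jk].
  by rewrite /= ltnn dfwithin.
by case: ifP => // _; rewrite dfwithout.
Qed.

Lemma prefix_closed k x (w : 'I_m -> V) : S x -> (forall j, S (w j)) ->
  forall j, S (prefix k x w j).
Proof. by move=> Sx Sw j; rewrite /prefix; case: ifP. Qed.

Lemma dfwith_closed (i : 'I_m) x (w : 'I_m -> V) : S x -> (forall j, S (w j)) ->
  forall j, S (dfwith w i x j).
Proof. by move=> Sx Sw j; case: dfwithP. Qed.

Lemma prefix_full x (w : 'I_m -> V) : prefix m x w = (fun=> x).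
Proof. by apply/funext => j; rewrite /prefix ltn_ord. Qed.

Lemma multilinear_diagZ c x : S x -> phi (fun=> c *: x) = c ^+ m *: phi (fun=> x).
Proof.
move=> Sx; have Sc : S (c *: x) by rewrite -[c *: x]addr0; apply: SL.
have h k : (k <= m)%N -> phi (prefix k (c *: x) (fun=> x)) = c ^+ k *: phi (fun=> x).
  elim: k => [|k IH] km; first by rewrite expr0 scale1r.
  rewrite prefixS multilinearZ //; last exact: prefix_closed.
  rewrite dfwith_prefix; have -> : dfwith (fun=> x) (Ordinal km) x = (fun=> x).
    by apply/funext => j; case: dfwithP.
  by rewrite (IH (ltnW km)) scalerA (exprS c k).
by rewrite -(h m) // prefix_full.
Qed.

(** Each slot raises the degree bound by two. Its [x2] part is shifted twice, its [x1] part once and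
    its [x0] part not at all; the last two are padded and add 0 to the top coefficient. *)
Lemma multilinear_quadratic_top x0 x1 x2 : S x0 -> S x1 -> S x2 ->
  poly_top (2 * m) (fun t => phi (fun=> t *: (t *: x2 + x1) + x0)) (phi (fun=> x2)).
Proof.
move=> Sx0 Sx1 Sx2; have Sx t : S (t *: (t *: x2 + x1) + x0) by do 2?apply: SL.
suff h k w : (k <= m)%N -> (forall j, S (w j)) ->
    poly_top (2 * k) (fun t => phi (prefix k (t *: (t *: x2 + x1) + x0) w)) (phi (prefix k x2 w)).
  have := h m (fun=> x0) (leqnn _) (fun=> Sx0); rewrite prefix_full.
  by congr poly_top; apply/funext => t; rewrite prefix_full.
elim: k w => [|k IH] w km Sw; first by exists (fun=> phi w) => [t|//]; rewrite muln0 big_ord1 expr0 scale1r.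
pose i := Ordinal km.
have IHi x : S x -> poly_top (2 * k)
    (fun t => phi (prefix k (t *: (t *: x2 + x1) + x0) (dfwith w i x)))
    (phi (prefix k x2 (dfwith w i x))).
  by move=> Sxx; apply: IH; [exact: ltnW|exact: dfwith_closed].
have E t : phi (prefix k.+1 (t *: (t *: x2 + x1) + x0) w) =
    t *: (t *: phi (prefix k (t *: (t *: x2 + x1) + x0) (dfwith w i x2))
      + phi (prefix k (t *: (t *: x2 + x1) + x0) (dfwith w i x1)))
    + phi (prefix k (t *: (t *: x2 + x1) + x0) (dfwith w i x0)).
  rewrite prefixS phiL //; [|exact: prefix_closed|exact: SL].
  by rewrite phiL ?dfwith_prefix //; apply: prefix_closed.
have -> : phi (prefix k.+1 x2 w) = phi (prefix k x2 (dfwith w i x2)) + 0 + 0.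
  by rewrite prefixS dfwith_prefix !addr0.
have -> : (2 * k.+1 = (2 * k).+2)%N by rewrite mulnS.
rewrite (funext E).
apply: (@poly_topD _ _ _ (fun t => t *: (_ + _)) (fun t => _) _ 0).
  apply: (poly_top_shift (f := fun t => t *: _ + _)).
  apply: (@poly_topD _ _ _ (fun t => t *: _) (fun t => _) _ 0).
    exact: poly_top_shift (IHi _ Sx2).
  exact: poly_top_widen (IHi _ Sx1).
exact: poly_top_widen (poly_top_widen (IHi _ Sx0)).
Qed.

End Multilinear.

(** * Rank-one operators *)

Section RankOne.
Context {R : realType} {H : hilbertType R}.
Implicit Types (u v w : H) (c : R[i]).

(** The operator u v^*, conjugate-linear in [v]. *)
Definition rk u v : H -> H := fun w => inner w v *: u.

Lemma rk_bounded u v : bounded_op (rk u v).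
Proof.
split=> [c w w'|]; first by rewrite /rk innerDl innerZl scalerDl scalerA.
exists (nrm u * nrm v); apply/op_boundE => w; rewrite /rk nrmZ mulrC -mulrA.
by rewrite ler_wpM2l ?nrm_ge0 // mulrC cauchy_schwarz.
Qed.

Lemma rk_adjoint u v : adjoint (rk u v) = rk v u.
Proof.
apply: adjoint_uniq; first exact: rk_bounded.
by move=> w w'; rewrite /rk innerZl innerZr -innerC mulrC.
Qed.

Lemma rkDl u u' v : rk (u + u') v = rk u v + rk u' v.
Proof. by apply/funext => w; rewrite fctE /rk scalerDr. Qed.
Lemma rkZl c u v : rk (c *: u) v = c *: rk u v.
Proof. by apply/funext => w; rewrite fctE /rk !scalerA mulrC. Qed.
Lemma rkDr u v v' : rk u (v + v') = rk u v + rk u v'.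
Proof. by apply/funext => w; rewrite fctE /rk innerDr scalerDl. Qed.
Lemma rkZr c u v : rk u (c *: v) = Num.conj c *: rk u v.
Proof. by apply/funext => w; rewrite fctE /rk innerZr scalerA. Qed.

Lemma rk_orthogonal u v u' v' : inner u u' = 0 -> inner v v' = 0 ->
  orthogonal_op (rk u v) (rk u' v').
Proof.
move=> uu vv; rewrite /orthogonal_op rk_adjoint /rk; split; apply/funext => w /=.
  by rewrite innerZl (inner_eq0C vv) mulr0 scale0r.
by rewrite innerZl uu mulr0 scale0r.
Qed.

(** Two independent vectors cannot both be multiples of [u], so one of them has a nonzero component
    orthogonal to [u]. Equal norms make u' + c u and u' - c u orthogonal for |c| = 1. *)
Lemma orthogonal_vector u : dim_ge2 H -> exists u', inner u' u = 0 /\ nrm u' = nrm u.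
Proof.
move=> [x [y xy]]; have [->|u0] := eqVneq u 0; first by exists 0; rewrite inner0l.
have N0 : nrm u != 0 by rewrite nrm_eq0.
pose f z := z - (inner z u / inner u u) *: u.
have iu : inner u u != 0 by rewrite innervv -(rmorph0 (real_complex R)) (inj_eq (@complexI R)) sqrf_eq0.
have fu z : inner (f z) u = 0 by rewrite innerDl innerNl innerZl divfK // subrr.
have aux z : f z != 0 -> exists u', inner u' u = 0 /\ nrm u' = nrm u.
  move=> z0; exists ((nrm u / nrm (f z))%:C *: f z); split; first by rewrite innerZl fu mulr0.
  by rewrite nrmZr ger0_norm ?divr_ge0 ?nrm_ge0 // divfK // nrm_eq0.
have [x0|] := eqVneq (f x) 0; last exact: aux.
have [y0|] := eqVneq (f y) 0; last exact: aux.
exfalso; have {}x0 : x = (inner x u / inner u u) *: u by apply/eqP; rewrite -subr_eq0 -/(f x) x0.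
have {}y0 : y = (inner y u / inner u u) *: u by apply/eqP; rewrite -subr_eq0 -/(f y) y0.
set al := inner x u / _ in x0; set be := inner y u / _ in y0.
have h1 : be *: x + (- al) *: y = 0.
  by rewrite x0 y0 !scalerA mulNr scaleNr mulrC subrr.
have [_ /eqP] := xy _ _ h1; rewrite oppr_eq0 => /eqP al0.
have h2 : 1 *: x + 0 *: y = 0 by rewrite x0 al0 !scale0r scaler0 addr0.
by have [/eqP] := xy _ _ h2; rewrite oner_eq0.
Qed.

End RankOne.

(** * Vanishing of orthogonally additive polynomials *)

Section Vanishing.
Context {R : realType} {H : hilbertType R} {X : topologicalLmodType R[i]}.
Variables (m : nat) (p : R) (P : (H -> H) -> X) (phi : ('I_m -> (H -> H)) -> X).
Hypothesis m2 : (2 <= m)%N.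
Hypothesis dim2 : dim_ge2 H.
Hypothesis p0 : 0 < p.
Hypothesis phiL : multilinear_on (schatten p) phi.
Hypothesis Pphi : forall x, schatten p x -> P x = phi (fun=> x).
Hypothesis Padd : orthogonally_additive p P.

Lemma rank_one_vanishing (u v : H) : nrm v = 1 -> P (rk u v) = 0.
Proof.
move=> v1; have [u1 [u1u Nu1]] := orthogonal_vector u dim2.
have [v2 [v2v Nv2]] := orthogonal_vector v dim2.
have os : onseq [:: v2; v].
  apply: onseq_cons; [|by rewrite Nv2|by move=> z; rewrite inE => /eqP ->].
  by apply: onseq_cons.
(* A linear space inside [schatten p] containing the four rank-one operators built from [u], [u1]
   and [v], [v2]; multilinearity is applied on it. *)
pose S := [set y : H -> H | bounded_op y /\ forall w, y (proj [:: v2; v] w) = y w].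
have SP y : S y -> schatten p y by move=> [by_ yp]; apply: schatten_finite_rank os yp.
have S0 : S 0.
  split=> //; rewrite -(scale0r (id : H -> H)); exact/bounded_opZ/bounded_op_id.
have SL (c : R[i]) y z : S y -> S z -> S (c *: y + z).
  move=> [by_ yp] [bz zp]; split; first by apply: bounded_opD => //; apply: bounded_opZ.
  by move=> w; rewrite !fctE yp zp.
have Srk a b : b \in [:: v2; v] -> S (rk a b).
  move=> hb; split; first exact: rk_bounded.
  by move=> w; rewrite /rk inner_proj.
have Sv a : S (rk a v) by apply: Srk; rewrite !inE eqxx orbT.
have Sv2 a : S (rk a v2) by apply: Srk; rewrite !inE eqxx.
have phiS : multilinear_on S phi.
  by move=> i w c y z Sw Sy Sz; apply: phiL => [j||]; apply: SP.
pose x0 := rk u1 v2; pose x1 := rk u1 v + rk u v2; pose x2 := rk u v.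
have Sx0 : S x0 := Sv2 u1.
have Sx2 : S x2 := Sv u.
have Sx1 : S x1 by rewrite /x1 -[rk u1 v]scale1r; apply: SL; [apply: Sv|apply: Sv2].
have SN y : S y -> S (- y) by move=> Sy; rewrite -scaleN1r -[_ *: y]addr0; apply: SL.
have SZ c y : S y -> S (c *: y) by move=> Sy; rewrite -[_ *: y]addr0; apply: SL.
(* Conjugate-linearity of [rk] in its second argument undoes the conjugate of t, so [A] is a
   polynomial in t; [B] is [A] at -t. *)
pose A t := t *: (t *: x2 + x1) + x0.
pose B t := t *: (t *: x2 + - x1) + x0.
have SA t : S (A t) := SL t _ _ (SL t _ _ Sx2 Sx1) Sx0.
have SB t : S (B t) := SL t _ _ (SL t _ _ Sx2 (SN _ Sx1)) Sx0.
have AE (t : R[i]) : A t = rk (u1 + t *: u) (v2 + Num.conj t *: v).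
  rewrite /A /x0 /x1 /x2 rkDl !rkDr !rkZl !rkZr conjCK !scalerDr !scalerA.
  by rewrite [LHS]addrC [X in _ + X = _]addrC -!addrA.
have BE (t : R[i]) : B t = rk (u1 - t *: u) (v2 - Num.conj t *: v).
  rewrite -!scaleNr -rmorphN -AE /A /B.
  by rewrite quadratic_opp.
have AB t : A t + B t = t *: (t *: (2 *: x2) + 0) + 2 *: x0 := quadratic_addN t x2 x1 x0.
(* [A + B] is again a quadratic curve, with leading vector 2 x2 and no linear term. *)
have top : poly_top (2 * m) (fun t => phi (fun=> t *: (t *: (2 *: x2) + 0) + 2 *: x0)
    - phi (fun=> A t) - phi (fun=> B t)) (phi (fun=> 2 *: x2) - phi (fun=> x2) - phi (fun=> x2)).
  apply: poly_topD; last by apply: poly_topN; apply: (multilinear_quadratic_top SL phiS) => //; apply: SN.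
  apply: poly_topD; last by apply: poly_topN; apply: (multilinear_quadratic_top SL phiS).
  by apply: (multilinear_quadratic_top SL phiS) => //; apply: SZ.
have /(poly_top_circle top) : forall t : R[i], cn t = 1 ->
    phi (fun=> t *: (t *: (2 *: x2) + 0) + 2 *: x0) - phi (fun=> A t) - phi (fun=> B t) = 0.
  move=> t t1; rewrite -AB -!Pphi; [|exact: SP|exact: SP|].
    have tt : t * Num.conj t = 1 by rewrite mul_conj_cn t1 expr1n.
    have orth (a b : H) (c : R[i]) : inner a b = 0 -> nrm a = nrm b -> c * Num.conj c = 1 ->
        inner (a + c *: b) (a - c *: b) = 0.
      move=> ab nab cc; rewrite innerDl !innerDr !innerNr !innerZl !innerZr.
      by rewrite ab (inner_eq0C ab) !innervv nab !mulr0 oppr0 addr0 add0r mulrA cc mul1r subrr.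
    rewrite Padd; [|exact: SP|exact: SP|].
      by rewrite addrAC addrK subrr.
    rewrite AE BE; apply: rk_orthogonal; apply: orth => //.
    by rewrite conjCK mulrC.
  by rewrite -[A t]scale1r; apply: SP; apply: SL.
rewrite (multilinear_diagZ S0 SL phiS) // -addrA -opprD -mulr2n -[phi _ *+ 2]scaler_nat -scalerBl.
move=> /eqP; rewrite scaler_eq0 => /orP[|/eqP h]; last by rewrite Pphi //; apply: SP.
rewrite subr_eq0 -natrX eqr_nat => /eqP h2; exfalso.
have : (2 ^ 1 < 2 ^ m)%N by rewrite ltn_exp2l.
by rewrite h2.
Qed.

(** The zero operator is [rk 0 v] for a unit vector [v]; it is the case of the empty family in
    [finite_rank_vanishing]. *)
Lemma vanishing_at_zero : P 0 = 0.
Proof.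
have [u [w uw]] := dim2.
pose v : H := (nrm u)^-1%:C *: u.
have u0 : u != 0.
  apply/negP => /eqP u0; have [] := uw 1 0; first by rewrite u0 scaler0 scale0r addr0.
  by move/eqP; rewrite oner_eq0.
have := @rank_one_vanishing 0 v (nrm_normalise u0).
by have -> : rk 0 v = 0 :> (H -> H); first by apply/funext => z; rewrite /rk scaler0.
Qed.

(** For an eigenvector v of |x|, <x v', x v> = <v', |x|^2 v> vanishes whenever v' is orthogonal to
    v. Hence [x \o proj s] and [rk (x v) v] are orthogonal on both sides, and the family can be
    built up one vector at a time. *)
Lemma finite_rank_vanishing x s : bounded_op x -> onseq s ->
  (forall v, v \in s -> exists r : R, modulus x v = r%:C *: v) ->
  P (x \o proj s) = 0.
Proof.
move=> bx; have [ba adj] := adjointP bx; have [pa aa] := modulusP bx.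
have xx v v' (r : R) : modulus x v = r%:C *: v -> inner v' v = 0 -> inner (x v') (x v) = 0.
  move=> av vv; have -> : inner (x v') (x v) = inner v' (modulus x (modulus x v)).
    by rewrite adj; have /= -> := congr1 (fun f => f v) aa.
  by rewrite av (linZ pa.1.1) av !innerZr vv !mulr0.
have sch s' : onseq s' -> schatten p (x \o proj s').
  move=> os; apply: (schatten_finite_rank p0 _ os) => [|v /=]; last by rewrite proj_idem.
  exact: bounded_op_comp bx (proj_bounded os).
elim: s => [_ _|v s IH os hs].
  have -> : x \o proj [::] = 0; last exact: vanishing_at_zero.
  by apply/funext => w /=; rewrite /proj big_nil (lin0 bx.1).
have os' : onseq s.
  case: os => /= /andP[_ us] os; split=> // y z ys zs.
  by apply: os; rewrite inE ?ys ?zs orbT.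
have vs : v \notin s by case: os => /= /andP[].
have v1 : nrm v = 1 by apply: onseq_nrm os _; rewrite mem_head.
have vw w : w \in s -> inner w v = 0.
  move=> ws; case: os => _ os; rewrite os ?inE ?eqxx ?ws ?orbT //.
  by case: eqP ws => // -> h; rewrite h in vs.
have -> : x \o proj (v :: s) = (x \o proj s) + rk (x v) v.
  by apply/funext => w; rewrite !fctE /= /proj big_cons (linD bx.1) (linZ bx.1) addrC.
have ov : onseq [:: v] by apply: onseq_cons.
rewrite Padd.
- by rewrite rank_one_vanishing // addr0 IH // => w ws; apply: hs; rewrite inE ws orbT.
- exact: sch.
- apply: (schatten_finite_rank p0 (rk_bounded _ _) ov) => w.
  by rewrite /rk inner_proj // mem_head.
have [r av] := hs v (mem_head _ _).
rewrite /orthogonal_op rk_adjoint /rk; split; apply/funext => w /=.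
  rewrite (linZ (proj_linear s)) (linZ bx.1).
  have -> : proj s v = 0; last by rewrite (lin0 bx.1) scaler0.
  by rewrite /proj big_seq big1 // => z zs; rewrite (inner_eq0C (vw _ zs)) scale0r.
rewrite /proj (lin_sum bx.1) inner_suml big_seq big1 ?scale0r // => z zs.
by rewrite (linZ bx.1) innerZl (xx _ _ _ av (vw _ zs)) mulr0.
Qed.

End Vanishing.

Theorem proposition3p9 (R : realType) (m : nat) (H : hilbertType R)
    (X : topologicalLmodType R[i]) (p : R) (P : (H -> H) -> X) :
  (2 <= m)%N ->
  dim_ge2 H ->
  hausdorff_space X ->
  0 < p ->
  homogeneous_polynomial_on (schatten p) m P ->
  schatten_continuous p P ->
  orthogonally_additive p P ->
  forall x, schatten p x -> P x = 0.
Proof.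
move=> m2 dim2 hX p0 [phi phiL Pphi] Pcont Padd x sx.
apply/eqP/negPn/negP => Px0.
(* An open set that contains [P x] but not 0; by continuity at [x] it contains the value of [P] at a
   close enough [x \o proj s], which is 0. *)
have [A [oA []]] := hausdorff_accessible hX Px0; rewrite !inE => PxA A0.
have [|e e0 he] := Pcont x sx A.
  by apply: open_nbhs_nbhs; split.
have [s [os sa] xs] := schatten_approx p0 sx e0.
have Py := finite_rank_vanishing m2 dim2 p0 phiL Pphi Padd sx.1 os sa.
have sy : schatten p (x \o proj s).
  apply: (schatten_finite_rank p0 _ os) => [|v /=]; last by rewrite proj_idem.
  exact: bounded_op_comp sx.1 (proj_bounded os).
by apply: A0; have := he _ sy xs; rewrite /= Py.
Qed.
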